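(* If $J(\lambda)<\infty$ then: (1) The optimal cost of the LQ problem \[ \max_{w\in \mathcal{L}_2[0,T]} \int_0^T \begin{bmatrix} x_a(t) \\ w(t) \end{bmatrix}^\top \begin{bmatrix} Q(t,\lambda) & S(t,\lambda) \\ S(t,\lambda)^\top & R(t,\lambda) \end{bmatrix} \begin{bmatrix} x_a(t) \\ w(t) \end{bmatrix} dt \quad\text{s.t. } \dot{x}_a = A_a x_a + B_a w,\ x_a(0)=\begin{bmatrix} 0 \\ 1 \end{bmatrix} \] is equal to $J(\lambda)$. (2) The optimal cost is achieved by $(x_a^*,w^* )$ satisfying, with $x_a^*(0) =\begin{bmatrix} 0 \\ 1 \end{bmatrix}$, \[ \dot{x}_a^* = \left(A_a-B_a R^{-1} ( Y B_a +S )^\top \right) x_a^*, \qquad w^* = -R^{-1} ( Y B_a +S )^\top x_a^*, \] where $Y$ is the solution to $\dot{Y} + A_a^\top Y + Y A_a + Q - (Y B_a + S) R^{-1} (Y B_a + S)^\top = 0$ with $Y(T)=0$. (3) $J$ satisfies the subgradient inequality $J(\alpha) \ge J(\lambda) + g^\top (\alpha-\lambda)$ for all $\alpha \in \mathbb{R}^m$, where $g\in \mathbb{R}^m$ is defined by \[ g_i := \int_0^T \begin{bmatrix} x_a^*(t) \\ w^*(t) \end{bmatrix}^\top \begin{bmatrix} Q_i(t) & S_i(t) \\ S_i(t)^\top & R_i(t) \end{bmatrix} \begin{bmatrix} x_a^*(t) \\ w^*(t) \end{bmatrix} dt . \]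
   Context: Finite horizon $T<\infty$. Augmented LTV system: $\dot{x}_a = A_a x_a + B_a w$, $v = C_{v,a} x_a + D_{vw} w$, $\delta_e = C_{e,a} x_a + D_{ew} w$, $x_a(t)\in\mathbb{R}^{n_x+1}$, all matrices continuous in time. Given IQC matrices $\{M_i\}_{i=1}^m$, define $\begin{bmatrix} Q_0 & S_0\\ S_0^\top & R_0\end{bmatrix} := \begin{bmatrix} C_{e,a} & D_{ew}\end{bmatrix}^\top\begin{bmatrix} C_{e,a} & D_{ew}\end{bmatrix}$, $\begin{bmatrix} Q_i & S_i\\ S_i^\top & R_i\end{bmatrix} := \begin{bmatrix} C_{v,a} & D_{vw}\\ 0 & I\end{bmatrix}^\top M_i \begin{bmatrix} C_{v,a} & D_{vw}\\ 0 & I\end{bmatrix}$, and $(Q,S,R)(t,\lambda)$ as $(Q_0,S_0,R_0)+\sum_i\lambda_i(Q_i,S_i,R_i)$, with $R(t,\lambda)\prec 0$ assumed. $J(\lambda)$ is the infimum over differentiable $P:[0,T]\to\mathbb{S}^{n_x+1}$ of $\begin{bmatrix}0\\1\end{bmatrix}^\top P(0)\begin{bmatrix}0\\1\end{bmatrix}$ subject to $P(T)\succeq 0$ and $\begin{bmatrix} \dot{P} + A_a^\top P + P A_a & P B_a \\ B_a^\top P & 0 \end{bmatrix} + \begin{bmatrix} Q & S \\ S^\top & R \end{bmatrix} \prec 0$ for all $t\in[0,T]$ ($+\infty$ if infeasible). When $J(\lambda)<\infty$, the Riccati equation above with $Y(T)=0$ has a solution on $[0,T]$ and $J(\lambda)=\begin{bmatrix}0\\1\end{bmatrix}^\top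 Y(0)\begin{bmatrix}0\\1\end{bmatrix}$. *)

(* Defs.v *)
From HB Require Import structures.
From mathcomp Require Import all_boot all_order all_algebra.
From mathcomp Require Import all_classical all_reals all_analysis.
Set Implicit Arguments. Unset Strict Implicit. Unset Printing Implicit Defensive.
Import Order.TTheory GRing.Theory Num.Theory.
Import numFieldNormedType.Exports.
Local Open Scope ring_scope.
Local Open Scope classical_set_scope.

Section Defs.
Context {R : realType}.

Definition leb := (@lebesgue_measure R).

Definition Rint (a b : R) (f : R -> R) : R := Rintegral leb `[a, b] f.

Definition mxcont (p q : nat) (T : R) (F : R -> 'M[R]_(p, q)) : Prop :=
  forall i j, {within `[0, T]%classic, continuous (fun t : R => F t i j)}.

Definition mxderivable (p q : nat) (F : R -> 'M[R]_(p, q)) (t : R) : Prop :=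
  forall i j, derivable (fun s => F s i j) t 1.
Definition mxderive (p q : nat) (F : R -> 'M[R]_(p, q)) (t : R) : 'M[R]_(p, q) :=
  \matrix_(i, j) (fun s => F s i j)^`() t.

Definition qf (k : nat) (X : 'M[R]_k) (v : 'cV[R]_k) : R := (v^T *m X *m v) 0 0.
Definition negdef (k : nat) (X : 'M[R]_k) : Prop :=
  forall v : 'cV[R]_k, v != 0 -> qf X v < 0.
Definition psd (k : nat) (X : 'M[R]_k) : Prop :=
  forall v : 'cV[R]_k, 0 <= qf X v.

Definition e_last (n : nat) : 'cV[R]_n.+1 := \col_i (i == ord_max)%:R.

Variables (n nw nv ne m : nat).
Implicit Types (Aa : R -> 'M[R]_n.+1) (Ba : R -> 'M[R]_(n.+1, nw))
  (Cva : R -> 'M[R]_(nv, n.+1)) (Dvw : R -> 'M[R]_(nv, nw))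
  (Cea : R -> 'M[R]_(ne, n.+1)) (Dew : R -> 'M[R]_(ne, nw))
  (M : 'I_m -> 'M[R]_(nv + nw)) (lam : 'I_m -> R).

Definition Nmat_i Cva Dvw M (i : 'I_m) (t : R) : 'M[R]_(n.+1 + nw) :=
  (block_mx (Cva t) (Dvw t) 0 1%:M)^T *m M i *m block_mx (Cva t) (Dvw t) 0 1%:M.

Definition Nmat Cva Dvw Cea Dew M lam (t : R) : 'M[R]_(n.+1 + nw) :=
  (row_mx (Cea t) (Dew t))^T *m row_mx (Cea t) (Dew t)
  + \sum_(i < m) lam i *: Nmat_i Cva Dvw M i t.

Definition Qm Cva Dvw Cea Dew M lam t : 'M[R]_n.+1 :=
  ulsubmx (Nmat Cva Dvw Cea Dew M lam t).
Definition Sm Cva Dvw Cea Dew M lam t : 'M[R]_(n.+1, nw) :=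
  ursubmx (Nmat Cva Dvw Cea Dew M lam t).
Definition Rm Cva Dvw Cea Dew M lam t : 'M[R]_nw :=
  drsubmx (Nmat Cva Dvw Cea Dew M lam t).

Definition feasibleP (T : R) Aa Ba Cva Dvw Cea Dew M lam
    (P : R -> 'M[R]_n.+1) : Prop :=
  [/\ forall t, t \in `[0, T] -> mxderivable P t,
      forall t, t \in `[0, T] -> (P t)^T = P t,
      psd (P T) &
      forall t, t \in `[0, T] ->
        negdef (block_mx (mxderive P t + (Aa t)^T *m P t + P t *m Aa t)
                         (P t *m Ba t) ((Ba t)^T *m P t) 0
                + Nmat Cva Dvw Cea Dew M lam t)].

(* J(lam): infimum, +oo if infeasible *)
Definition Jcost (T : R) Aa Ba Cva Dvw Cea Dew M lam : \bar R :=
  ereal_inf [set (qf (P 0) (e_last n))%:E | P in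
              [set P | feasibleP T Aa Ba Cva Dvw Cea Dew M lam P]].

Definition L2fun (T : R) (w : R -> 'cV[R]_nw) : Prop :=
  forall i, measurable_fun `[0, T]%classic (fun t => w t i 0) /\
            leb.-integrable `[0, T]%classic (fun t => ((w t i 0) ^+ 2)%:E).

(* (x, w) is an admissible pair: w in L2, x the (Caratheodory) solution
   of x' = Aa x + Ba w, x(0) = [0;1] on [0,T] *)
Definition admissible (T : R) Aa Ba (x : R -> 'cV[R]_n.+1) (w : R -> 'cV[R]_nw)
  : Prop :=
  [/\ L2fun T w, mxcont T x &
      forall t, t \in `[0, T] ->
        x t = e_last n + \col_i Rint 0 t (fun s => (Aa s *m x s + Ba s *m w s) i 0)].

Definition traj_cost (T : R) (N : R -> 'M[R]_(n.+1 + nw))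
   (x : R -> 'cV[R]_n.+1) (w : R -> 'cV[R]_nw) : R :=
  Rint 0 T (fun t => qf (N t) (col_mx (x t) (w t))).

Definition LQvalue (T : R) Aa Ba Cva Dvw Cea Dew M lam : \bar R :=
  ereal_sup [set (traj_cost T (Nmat Cva Dvw Cea Dew M lam) xw.1 xw.2)%:E |
              xw in [set xw | admissible T Aa Ba xw.1 xw.2]].

Definition riccati_sol (T : R) Aa Ba Cva Dvw Cea Dew M lam
   (Y : R -> 'M[R]_n.+1) : Prop :=
  Y T = 0 /\
  forall t, t \in `[0, T] -> mxderivable Y t /\
    mxderive Y t + (Aa t)^T *m Y t + Y t *m Aa t
      + Qm Cva Dvw Cea Dew M lam t
      - (Y t *m Ba t + Sm Cva Dvw Cea Dew M lam t)
          *m invmx (Rm Cva Dvw Cea Dew M lam t)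
          *m (Y t *m Ba t + Sm Cva Dvw Cea Dew M lam t)^T = 0.

End Defs.

(* Main.v *)
(* The Riccati solution is obtained from the Hamiltonian linear system
   (U, V)' = H (U, V), (U, V)(T) = (1, 0), as Y = V U^-1: strict feasibility of
   the LMI makes U invertible on all of [0, T], so no blow-up can occur, and only
   existence for linear ODEs (Picard iteration) is needed.  Completing the square
   turns the cost of every admissible pair (x, w) into
   e^T Y(0) e + \int (w - w* )^T R (w - w* ) with R < 0, where w* is the feedback;
   as w is only square integrable, x^T Y x is differentiated as a product of
   absolutely continuous functions, whose product rule is Fubini on a triangle.
   Since Y + eta exp(-c t) I is strictly feasible for large c and small eta, and
   since x^T P x plus the accumulated cost is nonincreasing along the optimal pair
   for every feasible P, the infimum J is e^T Y(0) e.  The cost being affine in the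
   multiplier, the same monotonicity at another multiplier alpha is the subgradient
   inequality. *)
Require Import Defs.
From HB Require Import structures.
From mathcomp Require Import all_boot all_order all_algebra ring lra.
From mathcomp Require Import all_classical all_reals all_analysis.
From mathcomp Require Import measurable_realfun.
Set Implicit Arguments. Unset Strict Implicit. Unset Printing Implicit Defensive.
Import Order.TTheory GRing.Theory Num.Theory.
Import numFieldNormedType.Exports.
Local Open Scope ring_scope.
Local Open Scope classical_set_scope.

(** * Real calculus *)

Section RealCalculus.
Context {R : realType}.
Implicit Types (f g F G : R -> R) (t a b T : R).

(** The data are continuous on [0, T] only, while [mxderivable] is a two-sided condition even at the
    end points. The coefficients are therefore extended by constants outside the segment and the
    linear equations solved on the whole line, where one weighted estimate replaces the gluing of
    local solutions. [Y] itself satisfies the LMI only weakly: by completion of squares its form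
    vanishes exactly on the graph of the feedback w = - K x. Adding eta exp(-c t) I contributes the
    derivative - c eta exp(-c t) I, which restores strictness once c dominates the closed-loop
    matrix; so c is chosen after [Y]. In (2) and (3) [Y] is an arbitrary solution, and its symmetry,
    on which completion of squares rests, comes from Y - Y^T solving a homogeneous Lyapunov equation
    with terminal value 0. Integration by parts for Lebesgue densities serves the cost identity for
    L2 inputs; the comparison with a feasible P takes place along the optimal pair, whose state is
    differentiable. *)

Lemma is_derive_continuous F t d : is_derive t 1 F d -> {for t, continuous F}.
Proof. by move=> [dF _]; apply/differentiable_continuous/derivable1_diffP. Qed.

Lemma derive1_is_derive F t d : is_derive t 1 F d -> F^`() t = d.
Proof. by move=> dF; rewrite derive1E; exact: derive_val. Qed.

Lemma is_derive_addr F G t dF dG : is_derive t 1 F dF -> is_derive t 1 G dG ->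
  is_derive t 1 (fun s => F s + G s) (dF + dG).
Proof. exact: is_deriveD. Qed.

Lemma is_derive_mulr F G t dF dG : is_derive t 1 F dF -> is_derive t 1 G dG ->
  is_derive t 1 (fun s => F s * G s) (dF * G t + F t * dG).
Proof.
move=> hF hG; apply: (is_derive_eq (@is_deriveM _ _ F G t 1 dF dG _ _)).
by rewrite addrC /GRing.scale/= (mulrC dF).
Qed.

Lemma is_derive_sumr (I : finType) (h : I -> R -> R) (dh : I -> R) t :
  (forall i, is_derive t 1 (h i) (dh i)) ->
  is_derive t 1 (fun s => \sum_i h i s) (\sum_i dh i).
Proof.
move=> H.
rewrite (_ : (fun s => _) = \sum_i h i); last first.
  by apply/funext => s; rewrite fct_sumE.
by elim/big_ind2 : _ => // [|*]; [exact: is_derive_cst|exact: is_deriveD].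
Qed.

Lemma derive_ge0_homo F a b :
  (forall t, a <= t <= b -> exists2 d, is_derive t 1 F d & 0 <= d) ->
  a <= b -> F a <= F b.
Proof.
move=> H ab.
have H1 t : t \in `[a, b]%R -> is_derive t 1 F (F^`() t) /\ 0 <= F^`() t.
  by rewrite in_itv/= => /H[d hd d0]; rewrite (derive1_is_derive hd).
apply: (@ger0_derive1_ndecr R F a b) => //.
- by move=> x xab; case: (H1 x (subset_itv_oo_cc xab)) => -[].
- by move=> x xab; case: (H1 x (subset_itv_oo_cc xab)).
- by apply: derivable_within_continuous => x xab; case: (H1 x xab) => -[].
Qed.

(** Both G - F and G + F are nondecreasing. This mean value inequality lets the Picard estimates be
    made on derivatives, in both time directions, without bounding integrals. *)
Lemma derive_dominated F G (dF dG : R -> R) :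
  (forall t, is_derive t 1 F (dF t)) -> (forall t, is_derive t 1 G (dG t)) ->
  (forall t, `|dF t| <= dG t) ->
  forall s t, `|F t - F s| <= `|G t - G s|.
Proof.
move=> hF hG le s t.
wlog st : s t / s <= t.
  move=> H; case: (leP s t) => [/H//|/ltW /H].
  by rewrite distrC (distrC (G s)).
apply: le_trans (ler_norm _).
have h1 : G s - F s <= G t - F t.
  apply: (@derive_ge0_homo (fun r => G r - F r)) => // r _.
  exists (dG r - dF r); first exact: is_deriveB.
  by rewrite subr_ge0; apply: le_trans (le r); exact: ler_norm.
have h2 : G s + F s <= G t + F t.
  apply: (@derive_ge0_homo (fun r => G r + F r)) => // r _.
  exists (dG r + dF r); first exact: is_deriveD.
  by rewrite addrC -lerBlDr sub0r; have := le r; rewrite ler_norml => /andP[].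
by rewrite ler_norml; apply/andP; split; lra.
Qed.

Lemma antiderivative f : continuous f ->
  exists F, forall t, is_derive t 1 F (f t).
Proof.
move=> cf.
have intf a b : (@lebesgue_measure R).-integrable `[a, b] (EFin \o f).
  apply: continuous_compact_integrable; first exact: segment_compact.
  exact: continuous_subspaceT.
pose I a t := Defs.Rint a t f.
have IB a b t : a <= b -> b <= t -> I a t - I a b = I b t.
  move=> ab bt; rewrite /I /Defs.Rint Rintegral_itvB//.
  rewrite Rintegral_itv_obnd_cbnd//; apply: integrableS (intf b t) => //.
  exact: subset_itv_oc_cc.
(* The base point [- |t| - 1] lies to the left of both t and 0, so only integrals over properly
   oriented intervals occur; by additivity the difference does not depend on it ([FE]). *)
pose F t := I (- `|t| - 1) t - I (- `|t| - 1) 0.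
have FE a t : a <= 0 -> a <= t -> F t = I a t - I a 0.
  move=> a0 at_.
  set b := - `|t| - 1.
  have b0 : b <= 0 by rewrite /b; have := normr_ge0 t; lra.
  have bt : b <= t by rewrite /b; have := ler_norm (- t); rewrite normrN; lra.
  rewrite /F -/b; case: (leP a b) => ab.
    by rewrite -(IB a b t)// -(IB a b 0)//; ring.
  by rewrite -(IB b a t)// ?(ltW ab)// -(IB b a 0)// ?(ltW ab)//; ring.
exists F => t.
(* To differentiate at t, the moving base point is replaced by a fixed one that stays to the left of
   all points near t. *)
set a := - `|t| - 3.
have at_ : a < t by rewrite /a; have := ler_norm (- t); rewrite normrN; lra.
have a0 : a <= 0 by rewrite /a; have := normr_ge0 t; lra.
apply: (@near_eq_is_derive _ _ _ (fun s => I a s - I a 0)).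
  near=> s; rewrite (FE a)//; apply: ltW; near: s; exact: lt_nbhsr.
have [d1 d2] : derivable (I a) t 1 /\ (I a)^`() t = f t.
  by apply: (@continuous_FTC1_closed R f a t (t + 1)) => //; [rewrite ltrDl|exact: cf].
rewrite -[f t]subr0; apply: is_deriveB.
by apply: DeriveDef; [exact: d1|rewrite -derive1E; exact: d2].
Unshelve. all: by end_near. Qed.

Lemma Rint_derive F f T : 0 <= T -> {within `[0, T], continuous f} ->
  (forall t, 0 <= t <= T -> is_derive t 1 F (f t)) ->
  Defs.Rint 0 T f = F T - F 0.
Proof.
rewrite le_eqVlt => /predU1P[<- _ _|T0 cf dF].
  by rewrite /Defs.Rint set_itv1 Rintegral_set1 subrr.
have oocc t : t \in `]0, T[%R -> 0 <= t <= T.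
  by move=> /subset_itv_oo_cc; rewrite in_itv.
rewrite /Defs.Rint /Rintegral.
rewrite (@continuous_FTC2 _ f F 0 T)//.
- have cF t : 0 <= t <= T -> {for t, continuous F}.
    by move=> /dF /is_derive_continuous.
  split.
  + by move=> t /oocc /dF [].
  + by apply: cvg_at_right_filter; apply: cF; rewrite lexx ltW.
  + by apply: cvg_at_left_filter; apply: cF; rewrite lexx ltW.
- by move=> t /oocc /dF/derive1_is_derive.
Qed.

End RealCalculus.

(** * Linear differential equations *)

Section ContinuityRules.
Context {R : realType} {X : topologicalType}.
Implicit Types f g : X -> R.

Lemma continuous_addr f g : continuous f -> continuous g ->
  continuous (fun x => f x + g x).
Proof. by move=> cf cg x; apply: cvgD; [exact: cf|exact: cg]. Qed.

Lemma continuous_mulr f g : continuous f -> continuous g ->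
  continuous (fun x => f x * g x).
Proof. by move=> cf cg x; apply: cvgM; [exact: cf|exact: cg]. Qed.

Lemma continuous_oppr f : continuous f -> continuous (fun x => - f x).
Proof. by move=> cf x; apply: cvgN; exact: cf. Qed.

Lemma continuous_cstr (c : R) : continuous (fun _ : X => c).
Proof. by move=> x; exact: cvg_cst. Qed.

Lemma continuous_sumr (I : Type) (r : seq I) (P : pred I) (F : I -> X -> R) :
  (forall i, continuous (F i)) ->
  continuous (fun x => \sum_(i <- r | P i) F i x).
Proof.
move=> cF; elim: r => [|i r IH].
  under eq_fun do rewrite big_nil; exact: continuous_cstr.
under eq_fun do rewrite big_cons; case: (P i) => //.
exact: continuous_addr.
Qed.

Lemma continuous_prodr (I : Type) (r : seq I) (P : pred I) (F : I -> X -> R) :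
  (forall i, continuous (F i)) ->
  continuous (fun x => \prod_(i <- r | P i) F i x).
Proof.
move=> cF; elim: r => [|i r IH].
  under eq_fun do rewrite big_nil; exact: continuous_cstr.
under eq_fun do rewrite big_cons; case: (P i) => //.
exact: continuous_mulr.
Qed.

End ContinuityRules.

Section Picard.
Context {R : realType}.

Lemma ler_pow2 (x y C : R) : (forall n, x <= y + C * 2^-1 ^+ n) -> x <= y.
Proof.
move=> H; have := @cvg_geometric R C 2^-1 _.
have h1 : `|2^-1 : R| < 1 by rewrite ger0_norm; lra.
move=> /(_ h1) cg.
have : (fun n => y + geometric C 2^-1 n) @ \oo --> y + 0.
  by apply: cvgD; [exact: cvg_cst|exact: cg].
rewrite addr0 => /cvgr_to_ge; apply.
by near=> n; exact: H.
Unshelve. all: by end_near. Qed.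

(** With [e n] the tail of the geometric series from n on, u + e is nonincreasing, u - e is
    nondecreasing, and every value of the latter is below every value of the former. The infimum of
    u + e is therefore within [e n] of [u n]. *)
Lemma geometric_limit (u : nat -> R) (C : R) :
  (forall n, `|u n.+1 - u n| <= C * 2^-1 ^+ n) ->
  exists l, forall n, `|l - u n| <= 2 * C * 2^-1 ^+ n.
Proof.
move=> H.
pose e n : R := 2 * C * 2^-1 ^+ n.
have eS n : C * 2^-1 ^+ n = e n - e n.+1.
  by rewrite /e exprS; field.
have C0 : 0 <= C by have := le_trans (normr_ge0 _) (H 0%N); rewrite expr0 mulr1.
have e0 n : 0 <= e n by rewrite !mulr_ge0// exprn_ge0// invr_ge0.
have v_anti n k : u (n + k)%N + e (n + k)%N <= u n + e n.
  elim: k => [|k IH]; first by rewrite addn0.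
  apply: le_trans IH; rewrite addnS.
  by have := H (n + k)%N; rewrite eS ler_norml => /andP[]; lra.
have w_mono n k : u n - e n <= u (n + k)%N - e (n + k)%N.
  elim: k => [|k IH]; first by rewrite addn0.
  apply: le_trans IH _; rewrite addnS.
  by have := H (n + k)%N; rewrite eS ler_norml => /andP[]; lra.
have wv n m : u n - e n <= u m + e m.
  apply: le_trans (w_mono n m) _; rewrite addnC; apply: le_trans (v_anti m n).
  by have := e0 (m + n)%N; lra.
pose V := range (fun n => u n + e n).
have V0 : V !=set0 by exists (u 0%N + e 0%N), 0%N.
exists (inf V) => n; rewrite -/(e n) ler_distl; apply/andP; split.
  by apply: lb_le_inf => // _ [m _ <-]; have := wv n m; lra.
by apply: ge_inf; [exists (u 0%N - e 0%N) => _ [m _ <-]; exact: wv|exists n].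
Qed.

Definition is_mxderive (p q : nat) (F : R -> 'M[R]_(p, q)) (t : R) (D : 'M[R]_(p, q)) :=
  forall i j, is_derive t 1 (fun s => F s i j) (D i j).

(** Picard iteration in a Bielecki norm: errors are measured against the weight [phi], which grows
    so fast that one integration halves them on the whole line at once, forward and backward in
    time. *)
Theorem linear_ode (p q : nat) (H : R -> 'M[R]_p) (a t0 : R) (X0 : 'M[R]_(p, q)) :
  (forall i j, continuous (fun t => H t i j)) ->
  (forall t i j, `|H t i j| <= a) ->
  exists X : R -> 'M[R]_(p, q), X t0 = X0 /\ forall t, is_mxderive X t (H t *m X t).
Proof.
move=> cH bH.
(* [I] is a total choice of the antiderivative vanishing at [t0]; at a discontinuous f its value is
   the dummy f. *)
have /choice[I IP] : forall f : R -> R, exists F : R -> R, continuous f ->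
    F t0 = 0 /\ forall t : R, is_derive t 1 F (f t).
  move=> f; have [cf|ncf] := pselect (continuous f); last by exists f.
  have [F dF] := antiderivative cf.
  exists (fun t => F t + - F t0) => _; split => [|t]; first by rewrite subrr.
  by rewrite -[f t]addr0; apply: is_derive_addr => //; exact: is_derive_cst.
pose step (Z : R -> 'M[R]_(p, q)) t : 'M[R]_(p, q) :=
  X0 + \matrix_(i, j) I (fun s => (H s *m Z s) i j) t.
pose mcont (Z : R -> 'M[R]_(p, q)) := forall i j, continuous (fun t => Z t i j).
have contHZ Z i j : mcont Z -> continuous (fun s => (H s *m Z s) i j).
  move=> cZ; under eq_fun do rewrite mxE.
  by apply: continuous_sumr => k; exact: continuous_mulr.
have stepP Z : mcont Z ->
    step Z t0 = X0 /\ forall t, is_mxderive (step Z) t (H t *m Z t).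
  move=> cZ; split => [|t i j].
    by apply/matrixP => i j; rewrite !mxE (IP _ (contHZ _ i j cZ)).1 addr0.
  under eq_fun do rewrite !mxE.
  have := is_derive_addr (is_derive_cst (X0 i j) t 1) ((IP _ (contHZ _ i j cZ)).2 t).
  by rewrite add0r.
have step_cont Z : mcont Z -> mcont (step Z).
  by move=> /stepP[_ dZ] i j t; exact: (is_derive_continuous (dZ t i j)).
(* An entry of H Z is at most p |a| times the largest entry of Z, so this L makes the integration
   gain 1/2; the successor and the + 1 keep L positive when p or a is 0. *)
pose L : R := 2 * p.+1%:R * (`|a| + 1).
have a1 : 0 < `|a| + 1 by have := normr_ge0 a; lra.
have L0 : 0 < L by rewrite /L !mulr_gt0.
(* [phi] is 2 cosh and [L * psi] is 2 sinh of L (t - t0): [psi] is the antiderivative of [phi]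
   vanishing at [t0], and |sinh| <= cosh gives [psi_phi]. *)
pose phi t := expR (L * (t - t0)) + expR (- (L * (t - t0))).
pose psi t := L^-1 * (expR (L * (t - t0)) + - expR (- (L * (t - t0)))).
have phi0 t : 0 <= phi t by rewrite addr_ge0// expR_ge0.
have psi0 : psi t0 = 0 by rewrite /psi subrr mulr0 oppr0 subrr mulr0.
have dlin (t : R) : is_derive t 1 (fun s => L * (s - t0)) L.
  rewrite -[X in is_derive _ _ _ X](_ : 0 * (t - t0) + L * (1 + 0) = L); last by ring.
  exact: is_derive_mulr.
have dpsi (t : R) : is_derive t 1 psi (phi t).
  have d1 : is_derive t 1 (fun s => expR (L * (s - t0))) (expR (L * (t - t0)) * L).
    exact: (is_derive1_comp (is_derive_expR _) (dlin t)).
  have d2 : is_derive t 1 (fun s => expR (- (L * (s - t0))))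
      (expR (- (L * (t - t0))) * - L).
    exact: (is_derive1_comp (is_derive_expR _) (is_deriveN (dlin t))).
  rewrite (_ : phi t = 0 * (expR (L * (t - t0)) + - expR (- (L * (t - t0))))
     + L^-1 * (expR (L * (t - t0)) * L + - (expR (- (L * (t - t0))) * - L))); last first.
    by rewrite /phi; field; exact: lt0r_neq0.
  exact: (is_derive_mulr (is_derive_cst _ _ _) (is_derive_addr d1 (is_deriveN d2))).
have psi_phi t : L * `|psi t| <= phi t.
  rewrite /psi normrM gtr0_norm ?invr_gt0// mulVKf ?lt0r_neq0//.
  apply: le_trans (ler_normB _ _) _.
  by rewrite !ger0_norm ?expR_ge0.
(* The propagation estimate behind Picard iteration: one integration of H Z
   gains a factor 1/2 in the weight phi. *)
have grow (F : R -> R) (Z : R -> 'M[R]_(p, q)) i j (B : R) : 0 <= B ->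
    (forall t : R, is_derive t 1 F ((H t *m Z t) i j)) ->
    (forall t i j, `|Z t i j| <= B * phi t) ->
    forall s t, `|F t - F s| <= 2^-1 * B * (L * `|psi t - psi s|).
  move=> B0 dF bZ s t.
  have nE (x y : R) : 2^-1 * B * (L * `|x - y|) =
     `|2^-1 * B * L * x - 2^-1 * B * L * y|.
    rewrite -mulrBr normrM (ger0_norm (_ : 0 <= 2^-1 * B * L)) ?mulrA//.
    by rewrite !mulr_ge0// ?invr_ge0// ltW.
  rewrite nE.
  have dG (r : R) : is_derive r 1 (fun u => 2^-1 * B * L * psi u) (2^-1 * B * L * phi r).
    have := is_derive_mulr (is_derive_cst (2^-1 * B * L) r 1) (dpsi r).
    by rewrite mul0r add0r.
  apply: (derive_dominated dF dG) => {s}t.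
  rewrite mxE; apply: le_trans (ler_norm_sum _ _ _) _.
  apply: (@le_trans _ _ (\sum_(k < p) (`|a| + 1) * (B * phi t))).
    apply: ler_sum => k _; rewrite normrM ler_pM//.
    by apply: le_trans (bH _ _ _) _; have := ler_norm a; lra.
  rewrite sumr_const card_ord -mulr_natl /L -subr_ge0.
  rewrite (_ : _ - _ = (p.+1%:R - p%:R) * ((`|a| + 1) * (B * phi t))); last by field.
  by rewrite -natrB// subSnn mul1r !mulr_ge0// ltW.
(* Starting from 0 makes the first increment the constant [X0], bounded by C <= C phi. *)
pose Z n := iter n step (fun=> 0).
have cZ n : mcont (Z n).
  elim: n => [|n IH]; last exact: step_cont.
  by move=> i j /=; under eq_fun do rewrite mxE; exact: continuous_cstr.
pose C := \sum_i \sum_j `|X0 i j|.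
have C0 : 0 <= C by do 2 apply: sumr_ge0 => ? _.
have phi1 t : 1 <= phi t.
  rewrite /phi; have [h|h] := leP 0 (L * (t - t0)).
    by rewrite -[1]addr0 lerD ?expR_ge0// -expR0 ler_expR.
  by rewrite addrC -[1]addr0 lerD ?expR_ge0// -expR0 ler_expR oppr_ge0 ltW.
have XC i j : `|X0 i j| <= C.
  rewrite /C (bigD1 i)//= (bigD1 j)//= -addrA lerDl addr_ge0 ?sumr_ge0// => k _.
  exact: sumr_ge0.
have phi_mono B t s : 0 <= B -> psi s = 0 ->
  2^-1 * B * (L * `|psi t - psi s|) <= 2^-1 * B * phi t.
  by move=> B0 ->; rewrite subr0 ler_wpM2l ?mulr_ge0 ?invr_ge0.
have ZS n t i j : `|Z n.+1 t i j - Z n t i j| <= (C * phi t) * 2^-1 ^+ n.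
  elim: n t i j => [|n IH] t i j.
    rewrite expr0 mulr1 /Z /= /step !mxE (_ : I _ t = 0) ?subr0 ?addr0.
      by apply: le_trans (XC i j) _; rewrite ler_peMr.
    have hc : continuous (fun s => (H s *m (0 : 'M[R]_(p, q))) i j).
      by under eq_fun do rewrite mulmx0 mxE; exact: continuous_cstr.
    have [I0 dI] := IP _ hc.
    rewrite -I0; apply: is_derive_0_is_cst => s.
    by have := dI s; rewrite mulmx0 [X in is_derive _ _ _ X]mxE.
  have [s1 d1] := stepP _ (cZ n.+1); have [s0 d0] := stepP _ (cZ n).
  rewrite /Z !(iterS n.+1) iterS -!/(Z _).
  have := @grow (fun s => step (Z n.+1) s i j - step (Z n) s i j)
    (fun s => Z n.+1 s - Z n s) i j (C * 2^-1 ^+ n) _ _ _ t0 t.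
  rewrite s1 s0 subrr subr0 => h.
  rewrite [leRHS](_ : _ = 2^-1 * (C * 2^-1 ^+ n) * phi t); last by rewrite exprS; ring.
  have e0 : 0 <= C * 2^-1 ^+ n by rewrite mulr_ge0// exprn_ge0// invr_ge0.
  apply: le_trans _ (phi_mono _ t _ e0 psi0).
  apply: h => [//|s|s k l].
    rewrite mulmxBr mxE [X in _ + X]mxE; apply: is_deriveB; [exact: d1|exact: d0].
  by rewrite mxE [X in _ + X]mxE; apply: le_trans (IH s k l) _; rewrite mulrAC.
have /choice[Xf XfP] : forall tij : R * 'I_p * 'I_q, exists l, forall n,
    `|l - Z n tij.1.1 tij.1.2 tij.2| <= 2 * (C * phi tij.1.1) * 2^-1 ^+ n.
  by move=> [[t i] j]; apply: geometric_limit => n; exact: ZS.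
pose X t : 'M[R]_(p, q) := \matrix_(i, j) Xf (t, i, j).
have XZ n t i j : `|X t i j - Z n t i j| <= 2 * C * 2^-1 ^+ n * phi t.
  by rewrite mxE; apply: le_trans (XfP (t, i, j) n) _ => /=; rewrite mulrA mulrAC.
have bX t i j : `|X t i j| <= 2 * C * phi t.
  by have := XZ 0%N t i j; rewrite [Z 0%N t i j]mxE subr0 expr0 mulr1.
have bZ n t i j : `|Z n t i j| <= 4 * C * phi t.
  rewrite -(subKr (X t i j) (Z n t i j)); apply: le_trans (ler_normB _ _) _.
  apply: (@le_trans _ _ (2 * C * phi t + 2 * C * phi t)); last by lra.
  apply: lerD; first exact: bX.
  apply: le_trans (XZ n t i j) _.
  rewrite ler_wpM2r// -[leRHS]mulr1 ler_wpM2l ?mulr_ge0//.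
  by rewrite exprn_ile1// ?invr_ge0//; lra.
(* The iterates share one Lipschitz bound with respect to [psi], by [grow] with B = 4 C, and it
   passes to the pointwise limit. This yields the continuity of X without a uniform convergence
   argument. *)
have lipX i j s t : `|X t i j - X s i j| <= 2 * C * L * `|psi t - psi s|.
  apply: (@ler_pow2 _ _ (2 * C * phi t + 2 * C * phi s)) => n.
  have h1 := XZ n.+1 t i j; have h2 := XZ n.+1 s i j.
  have [_ d] := stepP _ (cZ n).
  have C4 : 0 <= 4 * C by rewrite mulr_ge0.
  have h3 := @grow (fun s => Z n.+1 s i j) (Z n) i j (4 * C) C4
    (fun t => d t i j) (bZ n) s t.
  have -> : X t i j - X s i j = (X t i j - Z n.+1 t i j) +
    (Z n.+1 t i j - Z n.+1 s i j) - (X s i j - Z n.+1 s i j) by ring.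
  apply: le_trans (ler_normB _ _) _.
  apply: le_trans (lerD (le_trans (ler_normD _ _) (lerD h1 h3)) h2) _.
  rewrite exprS; set e := 2^-1 ^+ n; set w := `|psi t - psi s|.
  have e0 : 0 <= e by rewrite exprn_ge0// invr_ge0.
  have : 0 <= C * e * phi t + C * e * phi s by rewrite addr_ge0// !mulr_ge0.
  by lra.
have cX : mcont X.
  move=> i j t.
  have cpsi : {for t, continuous psi} by exact: (is_derive_continuous (dpsi t)).
  have : (fun s => 2 * C * L * `|psi s - psi t|) @ t --> (0 : R).
    rewrite [X in _ --> X](_ : _ = 2 * C * L * `|psi t - psi t|); last first.
      by rewrite subrr normr0 mulr0.
    apply: cvgM; first exact: cvg_cst.
    by apply: cvg_norm; apply: cvgB; [exact: cpsi|exact: cvg_cst].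
  move=> h; apply/cvgrPdist_le => e e0; move/cvgrPdist_le: h => /(_ e e0).
  apply: filterS => s; rewrite sub0r normrN ger0_norm ?mulr_ge0 ?(ltW L0)// => h.
  by rewrite distrC; apply: le_trans (lipX _ _ _ _) h.
have [sX dX] := stepP _ cX.
(* X is a fixed point because [step X] and X are both within a multiple of 2^-n of [Z n.+1], which
   is [step (Z n)]. *)
suff E t : step X t = X t.
  exists X; split=> [|t]; first by rewrite -E.
  by move=> i j; have := dX t i j; under eq_fun do rewrite E.
apply/matrixP => i j; apply/eqP; rewrite -subr_eq0 -normr_le0.
apply: (@ler_pow2 _ _ (2 * C * phi t)) => n; rewrite add0r.
have [sZ dZ] := stepP _ (cZ n).
have e0 : 0 <= 2^-1 ^+ n :> R by rewrite exprn_ge0// invr_ge0.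
have B0 : 0 <= 2 * C * 2^-1 ^+ n by rewrite !mulr_ge0.
have := @grow (fun s => step X s i j - step (Z n) s i j) (fun s => X s - Z n s)
  i j (2 * C * 2^-1 ^+ n) B0 _ _ t0 t.
rewrite sX sZ subrr subr0 => h.
have {}h : `|step X t i j - Z n.+1 t i j| <= 2^-1 * (2 * C * 2^-1 ^+ n) * phi t.
  apply: le_trans _ (phi_mono _ t _ B0 psi0); apply: h => [s|s k l].
    by rewrite mulmxBr mxE [X in _ + X]mxE; apply: is_deriveB; [exact: dX|exact: dZ].
  by rewrite mxE [X in _ + X]mxE; exact: XZ.
rewrite -(subrKA (Z n.+1 t i j)).
apply: le_trans (ler_normD _ _) _.
have h2 := XZ n.+1 t i j.
rewrite (distrC (Z _ _ _ _)); apply: le_trans (lerD h h2) _.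
by rewrite exprS; lra.
Qed.

End Picard.

(** * Quadratic forms and matrix calculus *)

Section BilinearForms.
Context {R : realType}.

Lemma trmx_add p q (M N : 'M[R]_(p, q)) : (M + N)^T = M^T + N^T.
Proof. exact: linearD. Qed.

Lemma trmx_opp p q (M : 'M[R]_(p, q)) : (- M)^T = - M^T.
Proof. exact: linearN. Qed.

Definition bf (p q : nat) (x : 'cV[R]_p) (M : 'M[R]_(p, q)) (y : 'cV[R]_q) : R :=
  (x^T *m M *m y) 0 0.

Lemma qfE p (M : 'M[R]_p) x : qf M x = bf x M x.
Proof. by []. Qed.

Lemma bf_sum p q (x : 'cV[R]_p) (M : 'M[R]_(p, q)) y :
  bf x M y = \sum_i \sum_j x i 0 * M i j * y j 0.
Proof.
rewrite /bf mxE exchange_big; apply: eq_bigr => j _.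
by rewrite mxE big_distrl/=; apply: eq_bigr => i _; rewrite mxE.
Qed.

Lemma trmx_scale p q (c : R) (M : 'M[R]_(p, q)) : (c *: M)^T = c *: M^T.
Proof. exact: linearZ. Qed.

Lemma bfDl p q (x y : 'cV[R]_p) (M : 'M[R]_(p, q)) z :
  bf (x + y) M z = bf x M z + bf y M z.
Proof. by rewrite /bf linearD/= !mulmxDl mxE. Qed.

Lemma bfDr p q (x : 'cV[R]_p) (M : 'M[R]_(p, q)) y z :
  bf x M (y + z) = bf x M y + bf x M z.
Proof. by rewrite /bf mulmxDr mxE. Qed.

Lemma bfDm p q (x : 'cV[R]_p) (M N : 'M[R]_(p, q)) y :
  bf x (M + N) y = bf x M y + bf x N y.
Proof. by rewrite /bf mulmxDr mulmxDl mxE. Qed.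

Lemma bfNl p q (x : 'cV[R]_p) (M : 'M[R]_(p, q)) z : bf (- x) M z = - bf x M z.
Proof. by rewrite /bf linearN/= !mulNmx mxE. Qed.

Lemma bfNr p q (x : 'cV[R]_p) (M : 'M[R]_(p, q)) z : bf x M (- z) = - bf x M z.
Proof. by rewrite /bf mulmxN mxE. Qed.

Lemma bfNm p q (x : 'cV[R]_p) (M : 'M[R]_(p, q)) z : bf x (- M) z = - bf x M z.
Proof. by rewrite /bf mulmxN mulNmx mxE. Qed.

Lemma bfZm p q (x : 'cV[R]_p) (c : R) (M : 'M[R]_(p, q)) z :
  bf x (c *: M) z = c * bf x M z.
Proof. by rewrite /bf -scalemxAr -scalemxAl mxE. Qed.

Lemma bf0l p q (M : 'M[R]_(p, q)) z : bf 0 M z = 0.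
Proof. by rewrite /bf trmx0 !mul0mx mxE. Qed.

Lemma bf0r p q (M : 'M[R]_(p, q)) z : bf z M 0 = 0.
Proof. by rewrite /bf mulmx0 mxE. Qed.

Lemma bf0m p q x y : bf x (0 : 'M[R]_(p, q)) y = 0.
Proof. by rewrite /bf mulmx0 mul0mx mxE. Qed.

Lemma bf_tr p q (x : 'cV[R]_p) (M : 'M[R]_(p, q)) y : bf x M y = bf y M^T x.
Proof.
have E : y^T *m M^T *m x = (x^T *m M *m y)^T by rewrite !trmx_mul trmxK mulmxA.
by rewrite /bf E [RHS]mxE.
Qed.

Lemma bf_mulr p q r (x : 'cV[R]_p) (M : 'M[R]_(p, q)) (N : 'M[R]_(q, r)) y :
  bf x (M *m N) y = bf x M (N *m y).
Proof. by rewrite /bf !mulmxA. Qed.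

Lemma bf_mull p q r (x : 'cV[R]_p) (M : 'M[R]_(q, p)) (N : 'M[R]_(q, r)) y :
  bf x (M^T *m N) y = bf (M *m x) N y.
Proof. by rewrite /bf trmx_mul !mulmxA. Qed.

Lemma bf_mul1l p q (M : 'M[R]_(p, q)) x y : bf (M *m x) 1%:M y = bf x M^T y.
Proof. by rewrite -bf_mull mulmx1. Qed.

Lemma bf_mul1r p q (M : 'M[R]_(p, q)) x y : bf x 1%:M (M *m y) = bf x M y.
Proof. by rewrite -bf_mulr mul1mx. Qed.

Lemma bf_sym p (x : 'cV[R]_p) (M : 'M[R]_p) y : M^T = M -> bf x M y = bf y M x.
Proof. by move=> sM; rewrite bf_tr sM. Qed.

Lemma qf_block p q (A : 'M[R]_p) (B : 'M[R]_(p, q)) C (D : 'M[R]_q) x w :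
  qf (block_mx A B C D) (col_mx x w) = bf x A x + bf x B w + bf w C x + bf w D w.
Proof.
rewrite /qf tr_col_mx mul_row_block mul_row_col !mulmxDl mxE.
by rewrite [X in X + _]mxE [X in _ + X]mxE /bf; ring.
Qed.

(** From |v_i v_j| <= (v_i^2 + v_j^2) / 2. A crude entrywise substitute for the operator norm,
    precise enough to choose the rate c in [riccati_feasible]. *)
Lemma qf_entries_le p (a : R) (M : 'M[R]_p) (v : 'cV[R]_p) :
  (forall i j, `|M i j| <= a) -> `|qf M v| <= p%:R * a * bf v 1%:M v.
Proof.
move=> bM; rewrite qfE.
have vv : bf v 1%:M v = \sum_i v i 0 ^+ 2.
  by rewrite /bf mulmx1 mxE; apply: eq_bigr => i _; rewrite mxE expr2.
have le i j : `|v i 0 * M i j * v j 0| <= a * (v i 0 ^+ 2 + v j 0 ^+ 2) / 2.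
  rewrite !normrM.
  have h : `|v i 0| * `|v j 0| <= (v i 0 ^+ 2 + v j 0 ^+ 2) / 2.
    rewrite -(real_normK (num_real (v i 0))) -(real_normK (num_real (v j 0))).
    by have := sqr_ge0 (`|v i 0| - `|v j 0|); rewrite sqrrB; lra.
  rewrite mulrAC [leRHS](_ : _ = (v i 0 ^+ 2 + v j 0 ^+ 2) / 2 * a); last by ring.
  by apply: ler_pM => //; rewrite mulr_ge0.
rewrite bf_sum vv.
apply: le_trans (ler_norm_sum _ _ _) _.
apply: (@le_trans _ _ (\sum_i \sum_j a * (v i 0 ^+ 2 + v j 0 ^+ 2) / 2)).
  apply: ler_sum => i _; apply: le_trans (ler_norm_sum _ _ _) _.
  by apply: ler_sum => j _; exact: le.
set u := fun i => v i 0 ^+ 2.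
have natE (x : R) : x *+ p = p%:R * x by rewrite mulr_natl.
have E i : \sum_j a * (u i + u j) / 2 = a / 2 * (p%:R * u i + \sum_j u j).
  rewrite -natE -(_ : \sum_(j < p) u i = u i *+ p); last by rewrite sumr_const card_ord.
  rewrite -big_split/= mulr_sumr.
  by apply: eq_bigr => j _; rewrite mulrAC.
under eq_bigr do rewrite E.
rewrite -mulr_sumr big_split/= -mulr_sumr sumr_const card_ord natE.
by rewrite le_eqVlt; apply/orP; left; apply/eqP; field.
Qed.

End BilinearForms.

(** * Entrywise calculus of matrix functions *)

Section MatrixDerivative.
Context {R : realType}.

Lemma is_mxderiveP p q (F : R -> 'M[R]_(p, q)) t D :
  is_mxderive F t D <-> mxderivable F t /\ mxderive F t = D.
Proof.
split => [H|[dF <-] i j].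
  split => [i j|]; first by case: (H i j).
  by apply/matrixP => i j; rewrite mxE; apply: derive1_is_derive; exact: H.
by rewrite mxE; apply: DeriveDef; [exact: dF|rewrite -derive1E].
Qed.

Lemma is_mxderive_cst p q (M : 'M[R]_(p, q)) t : is_mxderive (fun=> M) t 0.
Proof. by move=> i j; rewrite mxE; exact: is_derive_cst. Qed.

Lemma is_mxderiveD p q (F G : R -> 'M[R]_(p, q)) t dF dG :
  is_mxderive F t dF -> is_mxderive G t dG -> is_mxderive (fun s => F s + G s) t (dF + dG).
Proof.
move=> hF hG i j; rewrite mxE; under eq_fun do rewrite mxE.
exact: is_derive_addr.
Qed.

Lemma is_mxderiveN p q (F : R -> 'M[R]_(p, q)) t dF :
  is_mxderive F t dF -> is_mxderive (fun s => - F s) t (- dF).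
Proof.
move=> hF i j; rewrite mxE; under eq_fun do rewrite mxE.
exact: is_deriveN.
Qed.

Lemma is_mxderive_tr p q (F : R -> 'M[R]_(p, q)) t dF :
  is_mxderive F t dF -> is_mxderive (fun s => (F s)^T) t dF^T.
Proof. by move=> hF i j; rewrite mxE; under eq_fun do rewrite mxE. Qed.

Lemma is_mxderiveM p q r (F : R -> 'M[R]_(p, q)) (G : R -> 'M[R]_(q, r)) t dF dG :
  is_mxderive F t dF -> is_mxderive G t dG ->
  is_mxderive (fun s => F s *m G s) t (dF *m G t + F t *m dG).
Proof.
move=> hF hG i j; under eq_fun do rewrite mxE.
rewrite !mxE -big_split/=.
by apply: is_derive_sumr => k; exact: is_derive_mulr.
Qed.

Lemma is_mxderiveZ p q (f : R -> R) (F : R -> 'M[R]_(p, q)) (t : R) df dF :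
  is_derive t 1 f df -> is_mxderive F t dF ->
  is_mxderive (fun s => f s *: F s) t (df *: F t + f t *: dF).
Proof.
move=> hf hF i j; under eq_fun do rewrite mxE.
by rewrite !mxE; exact: is_derive_mulr.
Qed.

Lemma is_derive_bf p q (x : R -> 'cV[R]_p) (M : R -> 'M[R]_(p, q)) y (t : R) dx dM dy :
  is_mxderive x t dx -> is_mxderive M t dM -> is_mxderive y t dy ->
  is_derive t 1 (fun s => bf (x s) (M s) (y s))
    (bf dx (M t) (y t) + bf (x t) dM (y t) + bf (x t) (M t) dy).
Proof.
move=> hx hM hy.
have := is_mxderiveM (is_mxderiveM (is_mxderive_tr hx) hM) hy => /(_ 0 0).
by rewrite mulmxDl mxE [X in X + _]mxE.
Qed.

End MatrixDerivative.

Section MatrixContinuity.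
Context {R : realType} {X : topologicalType}.

(** The domain X is kept abstract because [mxcont T] is this notion at X = [subspace] of [0, T]; the
    rules below then apply to the segment by instantiation. *)
Definition mxcontinuous p q (F : X -> 'M[R]_(p, q)) :=
  forall i j, continuous (fun x => F x i j).

Lemma mxcontinuous_cst p q (M : 'M[R]_(p, q)) : mxcontinuous (fun=> M).
Proof. by move=> i j; exact: continuous_cstr. Qed.

Lemma mxcontinuousD p q (F G : X -> 'M[R]_(p, q)) :
  mxcontinuous F -> mxcontinuous G -> mxcontinuous (fun x => F x + G x).
Proof.
by move=> cF cG i j; under eq_fun do rewrite mxE; exact: continuous_addr.
Qed.

Lemma mxcontinuousN p q (F : X -> 'M[R]_(p, q)) :
  mxcontinuous F -> mxcontinuous (fun x => - F x).
Proof. by move=> cF i j; under eq_fun do rewrite mxE; exact: continuous_oppr. Qed.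

Lemma mxcontinuous_tr p q (F : X -> 'M[R]_(p, q)) :
  mxcontinuous F -> mxcontinuous (fun x => (F x)^T).
Proof. by move=> cF i j; under eq_fun do rewrite mxE; exact: cF. Qed.

Lemma mxcontinuousM p q r (F : X -> 'M[R]_(p, q)) (G : X -> 'M[R]_(q, r)) :
  mxcontinuous F -> mxcontinuous G -> mxcontinuous (fun x => F x *m G x).
Proof.
move=> cF cG i j; under eq_fun do rewrite mxE.
by apply: continuous_sumr => k; exact: continuous_mulr.
Qed.

Lemma mxcontinuous_row p q1 q2 (A : X -> 'M[R]_(p, q1)) (B : X -> 'M[R]_(p, q2)) :
  mxcontinuous A -> mxcontinuous B -> mxcontinuous (fun x => row_mx (A x) (B x)).
Proof.
move=> cA cB i j; under eq_fun do rewrite mxE.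
by case: (fintype.split j) => l; [exact: cA|exact: cB].
Qed.

Lemma mxcontinuous_col p1 p2 q (A : X -> 'M[R]_(p1, q)) (B : X -> 'M[R]_(p2, q)) :
  mxcontinuous A -> mxcontinuous B -> mxcontinuous (fun x => col_mx (A x) (B x)).
Proof.
move=> cA cB i j; under eq_fun do rewrite mxE.
by case: (fintype.split i) => l; [exact: cA|exact: cB].
Qed.

Lemma mxcontinuous_block p1 p2 q1 q2 (A : X -> 'M[R]_(p1, q1))
    (B : X -> 'M[R]_(p1, q2)) (C : X -> 'M[R]_(p2, q1)) (D : X -> 'M[R]_(p2, q2)) :
  mxcontinuous A -> mxcontinuous B -> mxcontinuous C -> mxcontinuous D ->
  mxcontinuous (fun x => block_mx (A x) (B x) (C x) (D x)).
Proof. by move=> cA cB cC cD; apply: mxcontinuous_col; exact: mxcontinuous_row. Qed.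

Lemma continuous_det p (F : X -> 'M[R]_p) :
  mxcontinuous F -> continuous (fun x => \det (F x)).
Proof.
move=> cF; apply: continuous_sumr => s; apply: continuous_mulr.
  exact: continuous_cstr.
by apply: continuous_prodr => i; exact: cF.
Qed.

Lemma mxcontinuous_adj p (F : X -> 'M[R]_p) :
  mxcontinuous F -> mxcontinuous (fun x => \adj (F x)).
Proof.
move=> cF i j; under eq_fun do rewrite mxE.
apply: continuous_mulr; first exact: continuous_cstr.
apply: continuous_det => k l; under eq_fun do rewrite !mxE.
exact: cF.
Qed.

Lemma continuous_bf p q (x : X -> 'cV[R]_p) (M : X -> 'M[R]_(p, q)) y :
  mxcontinuous x -> mxcontinuous M -> mxcontinuous y ->
  continuous (fun s => bf (x s) (M s) (y s)).
Proof.
move=> cx cM cy.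
exact: (mxcontinuousM (mxcontinuousM (mxcontinuous_tr cx) cM) cy).
Qed.

End MatrixContinuity.

(** * Continuity on [0, T] and extension to the line *)

Section OnSegment.
Context {R : realType}.
Variable T : R.
Hypothesis T0 : 0 < T.

Lemma mem_segment (t : R) : (t \in `[0, T]) = (0 <= t <= T).
Proof. by apply/idP/idP; rewrite inE/= in_itv. Qed.

Lemma within_ext (f g : R -> R) : (forall t, 0 <= t <= T -> f t = g t) ->
  {within `[0, T], continuous f} -> {within `[0, T], continuous g}.
Proof.
move=> fg; apply: subspace_eq_continuous => t.
by rewrite mem_segment => /fg.
Qed.

Lemma within_continuousV (f : R -> R) : (forall t, 0 <= t <= T -> f t != 0) ->
  {within `[0, T], continuous f} -> {within `[0, T], continuous (fun t => (f t)^-1)}.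
Proof.
move=> f0 cf; rewrite continuous_subspace_in => t; rewrite mem_segment => /f0 ft0.
by apply: cvgV => //; exact: cf.
Qed.

(** Cramer's rule: on the units the inverse is the adjugate divided by the determinant, both
    polynomial in the entries. *)
Lemma mxcont_invmx p (F : R -> 'M[R]_p) :
  (forall t, 0 <= t <= T -> F t \in unitmx) ->
  mxcont T F -> mxcont T (fun t => invmx (F t)).
Proof.
move=> uF cF i j.
apply: (@within_ext (fun t => (\det (F t))^-1 * (\adj (F t)) i j)).
  by move=> t /uF ut; rewrite /invmx ut [RHS]mxE.
apply: (@continuous_mulr R (subspace `[0, T])).
  apply: within_continuousV.
    by move=> t /uF; rewrite unitmxE unitfE.
  exact: (@continuous_det R (subspace `[0, T]) p F cF).
exact: (@mxcontinuous_adj R (subspace `[0, T]) p F cF).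
Qed.

(** The retraction of the line onto [0, T]. Composing with it extends coefficients known on the
    segment to bounded continuous ones on R, as [linear_ode] and [antiderivative] require. *)
Definition clamp (t : R) := Num.min T (Num.max 0 t).

Lemma clamp_in t : 0 <= clamp t <= T.
Proof.
rewrite /clamp; apply/andP; split; last by rewrite ge_min lexx.
by rewrite le_min ltW// le_max lexx.
Qed.

Lemma clamp_id t : 0 <= t <= T -> clamp t = t.
Proof. by move=> /andP[t0 tT]; rewrite /clamp max_r// min_r. Qed.

Lemma continuous_clamp (f : R -> R) : {within `[0, T], continuous f} ->
  continuous (fun t => f (clamp t)).
Proof.
move=> cf t.
have cc : {for t, continuous clamp}.
  apply: (@continuous_min R R (fun=> T) (fun t => Num.max 0 t)); first exact: cvg_cst.
  by apply: (@continuous_max R R (fun=> 0) id); [exact: cvg_cst|exact: cvg_id].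
have ct : clamp t \in `[0, T] by rewrite mem_segment clamp_in.
move: cf => /subspace_continuousP/(_ (clamp t)); rewrite inE in ct => /(_ ct).
move=> H A /H /cc h.
have {}h : \forall s \near t, `[0, T] (clamp s) -> A (f (clamp s)) by exact: h.
suff : \forall s \near t, A (f (clamp s)) by [].
apply: filterS h => s; apply.
by have := clamp_in s; rewrite -mem_segment inE.
Qed.

Lemma within_bounded (f : R -> R) : {within `[0, T], continuous f} ->
  exists a, forall t, 0 <= t <= T -> `|f t| <= a.
Proof.
move=> cf; have cn : {within `[0, T], continuous (fun t => `|f t|)}.
  by move=> t; apply: cvg_norm; exact: cf.
have [c _ H] := EVT_max (ltW T0) cn.
by exists `|f c| => t t0T; apply: H; rewrite in_itv.
Qed.

Lemma mxcont_bounded p q (F : R -> 'M[R]_(p, q)) : mxcont T F ->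
  exists a, forall t, 0 <= t <= T -> forall i j, `|F t i j| <= a.
Proof.
move=> cF.
have /choice[a aP] : forall ij : 'I_p * 'I_q, exists a,
    forall t, 0 <= t <= T -> `|F t ij.1 ij.2| <= a.
  by move=> [i j]; exact: within_bounded.
exists (\sum_ij `|a ij|) => t tT i j.
apply: le_trans (aP (i, j) t tT) _; apply: le_trans (ler_norm _) _.
by rewrite (bigD1 (i, j))//= lerDl sumr_ge0.
Qed.

Lemma mxcont_derivable p q (F : R -> 'M[R]_(p, q)) (dF : R -> 'M[R]_(p, q)) :
  (forall t, 0 <= t <= T -> is_mxderive F t (dF t)) -> mxcont T F.
Proof.
move=> H i j; apply: continuous_in_subspaceT => t.
by rewrite mem_segment => /H dFt; apply: (is_derive_continuous (dFt i j)).
Qed.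

Lemma mxcontD p q (F G : R -> 'M[R]_(p, q)) :
  mxcont T F -> mxcont T G -> mxcont T (fun t => F t + G t).
Proof. exact: (@mxcontinuousD R (subspace `[0, T])). Qed.

Lemma mxcontN p q (F : R -> 'M[R]_(p, q)) : mxcont T F -> mxcont T (fun t => - F t).
Proof. exact: (@mxcontinuousN R (subspace `[0, T])). Qed.

Lemma mxcont_tr p q (F : R -> 'M[R]_(p, q)) : mxcont T F -> mxcont T (fun t => (F t)^T).
Proof. exact: (@mxcontinuous_tr R (subspace `[0, T])). Qed.

Lemma mxcontM p q r (F : R -> 'M[R]_(p, q)) (G : R -> 'M[R]_(q, r)) :
  mxcont T F -> mxcont T G -> mxcont T (fun t => F t *m G t).
Proof. exact: (@mxcontinuousM R (subspace `[0, T])). Qed.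

Lemma mxcont_cst p q (M : 'M[R]_(p, q)) : mxcont T (fun=> M).
Proof. exact: (@mxcontinuous_cst R (subspace `[0, T])). Qed.

End OnSegment.

(** * Absolutely continuous functions *)

Section AbsolutelyContinuous.
Context {R : realType}.
Notation mu := (@lebesgue_measure R).
Implicit Types (f g : R -> R) (t T : R).

Lemma EFin_Rintegral (D : set R) f : measurable D -> mu.-integrable D (EFin \o f) ->
  (\int[mu]_(x in D) (f x)%:E)%E = (\int[mu]_(x in D) f x)%:E.
Proof. by move=> mD fi; rewrite /Rintegral fineK//; exact: integrable_fin_num. Qed.

(** Both sides are iterated integrals of f(r) g(s) over the triangle 0 <= r <= s <= t. *)
Lemma Rintegral_triangle f g t :
  mu.-integrable `[0, t] (EFin \o f) -> mu.-integrable `[0, t] (EFin \o g) ->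
  \int[mu]_(r in `[0, t]) (f r * \int[mu]_(s in `[r, t]) g s) =
  \int[mu]_(s in `[0, t]) (g s * \int[mu]_(r in `[0, s]) f r).
Proof.
move=> fi gi.
pose ft : R -> R := f \_ `[0, t]; pose gt : R -> R := g \_ `[0, t].
have patch_int (h : R -> R) (D : set R) : measurable D -> mu.-integrable D (EFin \o h) ->
    mu.-integrable setT (EFin \o (h \_ D)).
  by move=> mD hi; rewrite -restrict_EFin; apply/integrable_restrict; rewrite ?setTI.
have fti : mu.-integrable setT (EFin \o ft) by exact: patch_int.
have gti : mu.-integrable setT (EFin \o gt) by exact: patch_int.
have sub_int (h : R -> R) (a b : R) : mu.-integrable `[0, t] (EFin \o h) -> 0 <= a -> b <= t ->
    mu.-integrable `[a, b] (EFin \o h).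
  by move=> hi a0 bt; apply: integrableS hi => //; apply: subset_itv; rewrite bnd_simp.
(* The cut-offs [ft], [gt] and the indicator of r <= s turn the triangle into a kernel on the plane,
   to which Fubini applies. *)
pose k (p : R * R) : R := ft p.1 * gt p.2 * ((p.1 <= p.2)%R)%:R.
have mft : measurable_fun setT ft by apply/measurable_EFinP; exact: (measurable_int mu).
have mgt : measurable_fun setT gt by apply/measurable_EFinP; exact: (measurable_int mu).
pose TR := measurableTypeR R.
have mk : measurable_fun [set: TR * TR] (EFin \o k).
  apply/measurable_EFinP; apply: measurable_funM; first apply: measurable_funM.
  - by apply: measurableT_comp => //; exact: measurable_fst.
  - by apply: measurableT_comp => //; exact: measurable_snd.
  - rewrite (_ : (fun p => _) = \1_[set p : TR * TR | (p.1 <= p.2)%R]); last first.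
      by apply/funext => p; rewrite indicE mem_setE.
    apply: measurable_indic; rewrite -[X in measurable X]setTI.
    have := @measurable_fun_ler _ (TR * TR)%type R setT _ _
      (measurable_fst : measurable_fun _ (fst : TR * TR -> R)) measurable_snd.
    by move=> /(_ measurableT [set true] I).
(* By Tonelli it suffices that |k| is dominated by |ft(r)| |gt(s)|, whose double integral is a
   product of two finite ones. *)
have ki : (mu \x mu)%E.-integrable [set: TR * TR] (EFin \o k).
  apply/integrable12ltyP => //.
  have /integrableP[_ gfin] := gti.
  have /integrableP[_ ffin] := fti.
  apply: (@le_lt_trans _ _ (\int[mu]_x (`|(ft x)%:E| * \int[mu]_y `|(gt y)%:E|))%E).
    apply: ge0_le_integral => //.
    - by move=> x _; exact: integral_ge0.
    - by apply: (@measurable_fun_fubini_tonelli_F _ _ TR TR R mu (abse \o (EFin \o k)));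
        [exact: measurableT_comp|move=> x; exact: abse_ge0].
    - apply: emeasurable_funM => //.
      by apply: measurableT_comp => //; exact/measurable_EFinP.
    move=> x _; rewrite -ge0_integralZl//; last first.
      by apply: measurableT_comp => //; exact/measurable_EFinP.
    apply: ge0_le_integral => //.
    - apply: measurableT_comp => //.
      apply: (@measurableT_comp _ _ _ _ _ _ (EFin \o k) _ (fun y => (x, y))) => //.
      exact: measurable_pair1.
    - apply: emeasurable_funM => //.
      by apply: measurableT_comp => //; exact/measurable_EFinP.
    move=> y _; rewrite -abseM -EFinM !abse_EFin lee_fin /k /= normrM.
    by case: (x <= y); rewrite ?normr1 ?mulr1// normr0 mulr0.
  rewrite ge0_integralZr//; last 2 first.
  - by apply: measurableT_comp => //; exact/measurable_EFinP.
  - exact: integral_ge0.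
  rewrite lte_mul_pinfty//; first exact: integral_ge0.
  by rewrite ge0_fin_numE//; exact: integral_ge0.
have F1 r : (\int[mu]_s (k (r, s))%:E)%E = (ft r * \int[mu]_(s in `[r, t]) g s)%:E.
  have [r0|r0] := boolP (r \in `[0, t]); last first.
    rewrite /k /ft patchN// mul0r.
    by under eq_integral do rewrite /= !mul0r; rewrite integral0.
  have /andP[r00 rt] : 0 <= r <= t by rewrite inE/= in_itv in r0.
  under eq_integral => s _.
    rewrite (_ : k (r, s) = ft r * (g \_ `[r, t]) s); last first.
      rewrite /k /= -mulrA /gt !patchE; congr (_ * _).
      have [rs|rs] := leP r s.
        rewrite mulr1; congr (if _ then _ else _).
        apply/idP/idP; rewrite !inE/= !in_itv/= => /andP[h1 h2].
          by rewrite rs h2.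
        by rewrite h2 (le_trans r00).
      rewrite mulr0; case: ifPn => //; rewrite inE/= in_itv/= => /andP[].
      by rewrite leNgt rs.
    rewrite EFinM; over.
  rewrite integralZl//; last by apply: patch_int => //; exact: sub_int.
  rewrite EFinM; congr (_ * _)%E.
  by rewrite EFin_Rintegral -?Rintegral_mkcond//; apply: patch_int => //; exact: sub_int.
have F2 s : (\int[mu]_r (k (r, s))%:E)%E = (gt s * \int[mu]_(r in `[0, s]) f r)%:E.
  have [s0|s0] := boolP (s \in `[0, t]); last first.
    rewrite /k /gt /= patchN// mul0r.
    by under eq_integral do rewrite /= mulr0 mul0r; rewrite integral0.
  have /andP[s00 st] : 0 <= s <= t by rewrite inE/= in_itv in s0.
  under eq_integral => r _.
    rewrite (_ : k (r, s) = gt s * (f \_ `[0, s]) r); last first.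
      rewrite /k /= mulrAC mulrC /ft !patchE; congr (_ * _).
      have [rs|rs] := leP r s.
        rewrite mulr1; congr (if _ then _ else _).
        apply/idP/idP; rewrite !inE/= !in_itv/= => /andP[h1 h2].
          by rewrite rs h1.
        by rewrite h1 (le_trans h2).
      rewrite mulr0; case: ifPn => //; rewrite inE/= in_itv/= => /andP[].
      by rewrite [r <= s]leNgt rs.
    rewrite EFinM; over.
  rewrite integralZl//; last by apply: patch_int => //; exact: sub_int.
  rewrite EFinM; congr (_ * _)%E.
  by rewrite EFin_Rintegral -?Rintegral_mkcond//; apply: patch_int => //; exact: sub_int.
have E : (\int[mu]_x (\int[mu]_y (k (x, y))%:E) = \int[mu]_y (\int[mu]_x (k (x, y))%:E))%E.
  exact: (@Fubini _ _ TR TR R mu mu (EFin \o k) ki).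
have {}E : (\int[mu]_x (ft x * \int[mu]_(s in `[x, t]) g s)%:E =
            \int[mu]_y (gt y * \int[mu]_(r in `[0, y]) f r)%:E)%E.
  transitivity (\int[mu]_x (\int[mu]_y (k (x, y))%:E))%E.
    by apply: eq_integral => x _; rewrite F1.
  by rewrite E; apply: eq_integral => y _; rewrite F2.
rewrite [LHS]Rintegral_mkcond [RHS]Rintegral_mkcond /Rintegral; congr fine.
transitivity (\int[mu]_x (ft x * \int[mu]_(s in `[x, t]) g s)%:E)%E.
  apply: eq_integral => x _; rewrite /ft !patchE.
  by case: ifP => //; rewrite mul0r.
rewrite E; apply: eq_integral => x _; rewrite /gt !patchE.
by case: ifP => //; rewrite mul0r.
Qed.

End AbsolutelyContinuous.

Section Integrable.
Context {R : realType}.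
Variable T : R.
Hypothesis T0 : 0 < T.
Notation mu := (@lebesgue_measure R).
Implicit Types (f g F G : R -> R) (t : R).

Definition L1 (f : R -> R) := mu.-integrable `[0, T] (EFin \o f).

Lemma L1D f g : L1 f -> L1 g -> L1 (fun s => f s + g s).
Proof. by move=> fi gi; exact: (integrableD _ fi gi). Qed.

Lemma L1Z (c : R) f : L1 f -> L1 (fun s => c * f s).
Proof. by move=> fi; exact: (integrableZl _ c fi). Qed.

Lemma L1_continuous f : {within `[0, T], continuous f} -> L1 f.
Proof. by move=> cf; apply: continuous_compact_integrable => //; exact: segment_compact. Qed.

Lemma L1_ext f g : (forall t, 0 <= t <= T -> f t = g t) -> L1 f -> L1 g.
Proof.
move=> fg; apply: eq_integrable => // t; rewrite mem_segment => /fg /=.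
by move=> ->.
Qed.

Lemma L1M f g : {within `[0, T], continuous f} -> L1 g -> L1 (fun s => f s * g s).
Proof.
move=> cf gi.
have mf : measurable_fun (`[0, T] : set (measurableTypeR R))
    (f : measurableTypeR R -> R).
  exact: subspace_continuous_measurable_fun.
have bf_ : [bounded f x | x in `[0, T]].
  have [a aP] := within_bounded T0 cf.
  exists a; split; first exact: num_real.
  move=> b ab x; rewrite /= in_itv/= => xT.
  by apply: le_trans (ltW ab); exact: aP.
exact: (integrableMr _ mf bf_ gi).
Qed.

Lemma L1_sum (I : Type) (r : seq I) (P : pred I) (h : I -> R -> R) :
  (forall i, P i -> L1 (h i)) -> L1 (fun s => \sum_(i <- r | P i) h i s).
Proof.
move=> hi; rewrite /L1 (_ : _ \o _ = fun s => (\sum_(i <- r | P i) (h i s)%:E)%E).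
  exact: integrable_sum.
by apply/funext => s /=; rewrite sumEFin.
Qed.

Lemma L1_sub f t : L1 f -> 0 <= t <= T -> mu.-integrable `[0, t] (EFin \o f).
Proof.
move=> fi /andP[t0 tT]; apply: integrableS fi => //.
by apply: subset_itvl; rewrite bnd_simp.
Qed.

Lemma Rint_ext f g t : 0 <= t <= T -> (forall s, 0 <= s <= T -> f s = g s) ->
  Defs.Rint 0 t f = Defs.Rint 0 t g.
Proof.
move=> /andP[t0 tT] fg; apply: eq_Rintegral => s.
rewrite inE/= in_itv/= => /andP[s0 st]; apply: fg.
by rewrite s0 (le_trans st).
Qed.

Lemma Rint_add f g t : 0 <= t <= T -> L1 f -> L1 g ->
  Defs.Rint 0 t (fun s => f s + g s) = Defs.Rint 0 t f + Defs.Rint 0 t g.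
Proof. by move=> tT fi gi; rewrite /Defs.Rint RintegralD//; exact: L1_sub. Qed.

Lemma Rint_scale (c : R) f t : 0 <= t <= T -> L1 f ->
  Defs.Rint 0 t (fun s => c * f s) = c * Defs.Rint 0 t f.
Proof. by move=> tT fi; rewrite /Defs.Rint RintegralZl//; exact: L1_sub. Qed.

Lemma Rint_itv0 f : Defs.Rint 0 0 f = 0.
Proof. by rewrite /Defs.Rint set_itv1 Rintegral_set1. Qed.

(** The sign is read off the extended-valued integral and survives [fine], which sends infinite
    values to 0. *)
Lemma Rint_le0 f t : (forall s, 0 <= s <= t -> f s <= 0) -> Defs.Rint 0 t f <= 0.
Proof.
move=> f0; have Nf0 s : `[0, t]%classic s -> (0 <= (- f s)%:E)%E.
  by rewrite /= in_itv/= => /f0 fs; rewrite lee_fin oppr_ge0.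
rewrite /Defs.Rint /Rintegral fine_le0//.
rewrite (_ : integral _ _ _ = (- \int[mu]_(s in `[0%R, t]) (- f s)%:E)%E).
  by rewrite oppe_le0; exact: integral_ge0.
by rewrite -integral_ge0N//; apply: eq_integral => s _; rewrite EFinN oppeK.
Qed.

Lemma Rint_sum (I : finType) (h : I -> R -> R) t : 0 <= t <= T ->
  (forall i, L1 (h i)) ->
  Defs.Rint 0 t (fun s => \sum_i h i s) = \sum_i Defs.Rint 0 t (h i).
Proof.
move=> tT hi; elim: (index_enum I) => [|i r IH].
  under eq_fun do rewrite big_nil.
  by rewrite big_nil /Defs.Rint Rintegral_cst// mul0r.
under eq_fun do rewrite big_cons.
by rewrite Rint_add// ?IH ?big_cons//; exact: L1_sum.
Qed.

(* F is absolutely continuous on [0, T] with density f. *)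
Definition isac F f := [/\ {within `[0, T], continuous F}, L1 f &
  forall t, 0 <= t <= T -> F t = F 0 + Defs.Rint 0 t f].

Lemma isac_derive F f : {within `[0, T], continuous f} ->
  (forall t, 0 <= t <= T -> is_derive t 1 F (f t)) -> isac F f.
Proof.
move=> cf dF; split.
- apply: continuous_in_subspaceT => t; rewrite mem_segment => /dF.
  exact: is_derive_continuous.
- exact: L1_continuous.
move=> t /andP[t0 tT].
have cft : {within `[0, t], continuous f}.
  by apply: continuous_subspaceW cf; apply: subset_itvl; rewrite bnd_simp.
have dFt s : 0 <= s <= t -> is_derive s 1 F (f s).
  by move=> /andP[s0 st]; apply: dF; rewrite s0 (le_trans st).
by rewrite (Rint_derive t0 cft dFt) addrC subrK.
Qed.

Lemma isac_sum (I : finType) (F f : I -> R -> R) : (forall i, isac (F i) (f i)) ->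
  isac (fun s => \sum_i F i s) (fun s => \sum_i f i s).
Proof.
move=> h; split.
- by apply: (@continuous_sumr R (subspace `[0, T])) => i; case: (h i).
- by apply: L1_sum => i _; case: (h i).
move=> t tT; rewrite Rint_sum//; last by move=> i; case: (h i).
by rewrite -big_split/=; apply: eq_bigr => i _; case: (h i) => _ _; exact.
Qed.

Lemma isacM F f G g : isac F f -> isac G g ->
  isac (fun s => F s * G s) (fun s => f s * G s + F s * g s).
Proof.
move=> [cF fi hF] [cG gi hG].
have fGi : L1 (fun s => f s * G s).
  by apply: (@L1_ext (fun s => G s * f s)) (L1M cG fi) => s _; rewrite mulrC.
have Fgi : L1 (fun s => F s * g s) by exact: L1M.
split; [exact: (@continuous_mulr R (subspace `[0, T]))|exact: L1D|].
move=> t tT; rewrite Rint_add//.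
have /andP[t0 tT'] := tT.
pose IF s := Defs.Rint 0 s f; pose IG s := Defs.Rint 0 s g.
have st s : 0 <= s <= t -> 0 <= s <= T.
  by move=> /andP[-> st]; exact: le_trans st tT'.
(* [IG t - IG s] is the integral of g over [s, t], so this is the triangle identity. [E1] and [E2]
   rewrite its two sides through F and G, which gives integration by parts. *)
have tri : Defs.Rint 0 t (fun s => f s * (IG t - IG s)) =
           Defs.Rint 0 t (fun s => g s * IF s).
  rewrite -[RHS]Rintegral_triangle; [|exact: L1_sub..].
  apply: eq_Rintegral => s; rewrite inE/= in_itv/= => /[dup] /andP[s0 ls] _.
  congr (_ * _); rewrite /IG /Defs.Rint Rintegral_itvB//.
  - rewrite Rintegral_itv_obnd_cbnd//.
    apply: integrableS (L1_sub gi tT) => //; apply: subset_itv; rewrite bnd_simp//.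
  - exact: L1_sub.
have E1 : Defs.Rint 0 t (fun s => f s * (IG t - IG s)) =
    G t * IF t - Defs.Rint 0 t (fun s => f s * G s).
  rewrite (@Rint_ext _ (fun s => G t * f s + -1 * (f s * G s)))//.
    by rewrite Rint_add ?Rint_scale//; [rewrite mulN1r|exact: L1Z..].
  by move=> s sT; rewrite (hG t)// (hG s)// -/(IG t) -/(IG s); ring.
have E2 : Defs.Rint 0 t (fun s => g s * IF s) =
    Defs.Rint 0 t (fun s => F s * g s) - F 0 * IG t.
  rewrite (@Rint_ext _ (fun s => F s * g s + (- F 0) * g s))//.
    by rewrite Rint_add ?Rint_scale// ?mulNr//; exact: L1Z.
  by move=> s sT; rewrite (hF s)// -/(IF s); ring.
have -> : Defs.Rint 0 t (fun s => F s * g s) =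
    G t * IF t - Defs.Rint 0 t (fun s => f s * G s) + F 0 * IG t.
  by rewrite -E1 tri E2 subrK.
by rewrite {1}(hF t)// {1 2}(hG t)// -/(IF t) -/(IG t); ring.
Qed.

End Integrable.

(** * Completion of squares *)

Section CompletionOfSquares.
Context {R : realType}.

Lemma negdef_unitmx k (X : 'M[R]_k) : negdef X -> X \in unitmx.
Proof.
move=> nX; rewrite unitmxE unitfE; apply/negP => /eqP/eqP/det0P[v v0 vX].
have : v^T != 0 by rewrite -trmx0 (inj_eq trmx_inj).
by move=> /nX; rewrite /qf trmxK vX mul0mx mxE ltxx.
Qed.

Variables (n nw : nat) (A : 'M[R]_n) (B : 'M[R]_(n, nw)) (N : 'M[R]_(n + nw)).
Hypothesis symN : N^T = N.

Let Q : 'M[R]_n := ulsubmx N.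
Let S : 'M[R]_(n, nw) := ursubmx N.
Let G : 'M[R]_nw := drsubmx N.

Lemma ulsubmx_sym : Q^T = Q. Proof. by rewrite /Q trmx_ulsub symN. Qed.
Lemma drsubmx_sym : G^T = G. Proof. by rewrite /G trmx_drsub symN. Qed.

Lemma qf_sym_block x w :
  qf N (col_mx x w) = bf x Q x + 2 * bf x S w + bf w G w.
Proof.
rewrite -{1}[N]submxK qf_block -/Q -/S -/G.
have -> : dlsubmx N = S^T by rewrite /S trmx_ursub symN.
by rewrite -bf_tr; ring.
Qed.

(** Along x' = A x + B w the right-hand side is the derivative of x^T P x plus the running cost: the
    LMI is a strict dissipation inequality. *)
Lemma qf_lmi (P dP : 'M[R]_n) x w : P^T = P ->
  qf (block_mx (dP + A^T *m P + P *m A) (P *m B) (B^T *m P) 0 + N) (col_mx x w)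
  = bf x dP x + 2 * bf x P (A *m x + B *m w) + qf N (col_mx x w).
Proof.
move=> sP; rewrite !qfE bfDm; congr (_ + _).
rewrite -qfE.
rewrite [LHS]qf_block bf0m addr0 2!bfDm !bf_mull !bf_mulr bfDr.
by rewrite (bf_sym (A *m x) _ sP) (bf_sym (B *m w) _ sP); ring.
Qed.

(** The residual E is left free: E = 0 gives the cost identity for [Y], and a negative E the strict
    feasibility of its perturbation. The cross terms match because G K = L^T. *)
Lemma riccati_square (Y dY E : 'M[R]_n) x w : Y^T = Y -> G \in unitmx ->
  dY + A^T *m Y + Y *m A + Q - (Y *m B + S) *m (invmx G *m (Y *m B + S)^T) = E ->
  bf x dY x + 2 * bf x Y (A *m x + B *m w) + qf N (col_mx x w)
  = bf x E x + qf G (w + invmx G *m (Y *m B + S)^T *m x).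
Proof.
move=> sY uG <-; set L := Y *m B + S; set K := invmx G *m L^T.
have sG := drsubmx_sym.
have GK : G *m K = L^T by rewrite /K mulKVmx.
have wGK : bf w G (K *m x) = bf x L w by rewrite -bf_mulr GK -bf_tr.
have KGK : bf (K *m x) G (K *m x) = bf x (L *m K) x.
  by rewrite -bf_mulr GK -bf_tr -bf_mulr.
rewrite qf_sym_block qfE !bfDl !bfDr (bf_sym (K *m x) w sG) wGK KGK !bfDm bfNm.
rewrite bf_mull (bf_sym (A *m x) x sY) !bf_mulr -/Q /L bfDm bf_mulr -/S -/G.
by ring.
Qed.

End CompletionOfSquares.

(** * Pointwise derivatives, determinants and inverses *)

Section LocalDerivative.
Context {R : realType}.

(** Caratheodory's form F z - F t = g z (z - t), with g continuous at t and g t = d > 0, fixes the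
    sign just left of t from the derivative at t alone. *)
Lemma derive_gt0_left (F : R -> R) (s t d : R) :
  is_derive t 1 F d -> 0 < d -> s < t -> exists z, s < z < t /\ F z < F t.
Proof.
move=> /is_derive1_caratheodory[g [gE cg gt]] d0 st.
have g0 : \forall z \near t, 0 < g z by apply: (cvgr_gt _ cg); rewrite gt.
have gl : \forall z \near t^'-, 0 < g z by exact: (cvg_at_left_filter _ g0).
near t^'- => z.
exists z; have zt : z < t by near: z; exact: nbhs_left_lt.
split; first by rewrite zt andbT; near: z; exact: nbhs_left_gt.
rewrite -subr_lt0 gE nmulr_llt0 ?subr_lt0//.
by near: z.
Unshelve. all: by end_near. Qed.

Lemma is_derive_uniq (F : R -> R) (t d e : R) :
  is_derive t 1 F d -> is_derive t 1 F e -> d = e.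
Proof. by move=> [_ <-] [_ <-]. Qed.

Lemma is_mxderive_uniq p q (F : R -> 'M[R]_(p, q)) t D E : is_mxderive F t D ->
  is_mxderive F t E -> D = E.
Proof. by move=> hD hE; apply/matrixP => i j; apply: is_derive_uniq (hD i j) (hE i j). Qed.

Lemma derivable_det p (F : R -> 'M[R]_p) (t : R) :
  (forall i j, derivable (fun s => F s i j) t 1) ->
  derivable (fun s => \det (F s)) t 1.
Proof.
move=> dF.
have dsum (I : Type) (r : seq I) (h : I -> R -> R) :
    (forall i, derivable (h i) t 1) -> derivable (fun s => \sum_(i <- r) h i s) t 1.
  move=> dh; elim: r => [|i r IH].
    by under eq_fun do rewrite big_nil; exact: derivable_cst.
  under eq_fun do rewrite big_cons.
  exact: (derivableD (dh i) IH).
have dprod (I : Type) (r : seq I) (h : I -> R -> R) :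
    (forall i, derivable (h i) t 1) -> derivable (fun s => \prod_(i <- r) h i s) t 1.
  move=> dh; elim: r => [|i r IH].
    by under eq_fun do rewrite big_nil; exact: derivable_cst.
  under eq_fun do rewrite big_cons.
  exact: (derivableM (dh i) IH).
apply: dsum => s; apply: (derivableM (derivable_cst _ _ _)).
by apply: dprod => i; exact: dF.
Qed.

Lemma mxderivable_invmx p (F : R -> 'M[R]_p) t :
  mxderivable F t -> F t \in unitmx -> mxderivable (fun s => invmx (F s)) t.
Proof.
move=> dF uF i j.
have ddet : derivable (fun s => \det (F s)) t 1 by exact: derivable_det.
have det0 : \det (F t) != 0 by rewrite -unitfE -unitmxE.
apply: (@near_eq_derivable _ _ _ (fun s => (\det (F s))^-1 * (\adj (F s)) i j)).
  have cdet : {for t, continuous (fun s => \det (F s))}.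
    exact/differentiable_continuous/derivable1_diffP.
  have : \forall s \near t, \det (F s) != 0 by exact: (cvgr_neq0 _ cdet).
  apply: filterS => s ds; rewrite /invmx unitmxE unitfE ds.
  by rewrite [RHS]mxE.
apply: derivableM; first exact: derivableV.
under eq_fun do rewrite mxE.
apply: (derivableM (derivable_cst _ _ _)); apply: derivable_det => k l.
by under eq_fun do rewrite !mxE; exact: dF.
Qed.

Lemma unitmx_near p (F : R -> 'M[R]_p) t D :
  is_mxderive F t D -> F t \in unitmx -> \forall s \near t, F s \in unitmx.
Proof.
move=> dF uF.
have ddet : derivable (fun s => \det (F s)) t 1.
  by apply: derivable_det => i j; case: (dF i j).
have cdet : {for t, continuous (fun s => \det (F s))}.
  exact/differentiable_continuous/derivable1_diffP.
have : \forall s \near t, \det (F s) != 0.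
  by apply: (cvgr_neq0 _ cdet); rewrite -unitfE -unitmxE.
by apply: filterS => s; rewrite unitmxE unitfE.
Qed.

End LocalDerivative.

(** * Riccati and Hamiltonian equations *)

(* Proves identities between sums of matrix products, the products being atoms. *)
Ltac mx_ring :=
  repeat match goal with |- context [@mulmx ?R ?m ?n ?p ?a ?b] =>
    let z := fresh "z" in set z := (@mulmx R m n p a b); clearbody z end;
  apply/matrixP => ? ?; rewrite !mxE; ring.

Section LinearQuadratic.
Context {R : realType}.
Variables (n nw : nat) (T : R).
Hypothesis T0 : 0 < T.
Variables (A : R -> 'M[R]_n) (B : R -> 'M[R]_(n, nw)).
Hypotheses (cA : mxcont T A) (cB : mxcont T B).
Implicit Types (N : R -> 'M[R]_(n + nw)) (P Y : R -> 'M[R]_n).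

(** The IQC structure is condensed into a single weight N, so that one theory serves the multipliers
    [lam] and [alpha]. *)
Definition lmi N P t := block_mx (mxderive P t + (A t)^T *m P t + P t *m A t)
  (P t *m B t) ((B t)^T *m P t) 0 + N t.

Definition feasible N P := [/\ forall t, 0 <= t <= T -> mxderivable P t,
  forall t, 0 <= t <= T -> (P t)^T = P t, psd (P T) &
  forall t, 0 <= t <= T -> negdef (lmi N P t)].

Definition gain N Y t : 'M[R]_(nw, n) :=
  invmx (drsubmx (N t)) *m (Y t *m B t + ursubmx (N t))^T.

(** A residual rather than an equation, with the derivative as an argument: the perturbation of [Y]
    is judged by how negative it makes this matrix. *)
Definition riccati_res N (Y dY : R -> 'M[R]_n) t : 'M[R]_n :=
  dY t + (A t)^T *m Y t + Y t *m A t + ulsubmx (N t)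
  - (Y t *m B t + ursubmx (N t)) *m gain N Y t.

Definition riccati N Y dY :=
  forall t, 0 <= t <= T -> is_mxderive Y t (dY t) /\ riccati_res N Y dY t = 0.

Variable N : R -> 'M[R]_(n + nw).
Hypotheses (cN : mxcont T N)
  (symN : forall t, 0 <= t <= T -> (N t)^T = N t)
  (negN : forall t, 0 <= t <= T -> negdef (drsubmx (N t))).

Let Q t : 'M[R]_n := ulsubmx (N t).
Let S t : 'M[R]_(n, nw) := ursubmx (N t).
Let G t : 'M[R]_nw := drsubmx (N t).

Let uG t : 0 <= t <= T -> G t \in unitmx.
Proof. by move=> /negN/negdef_unitmx. Qed.

Let sG t : 0 <= t <= T -> (G t)^T = G t.
Proof. by move=> /symN/drsubmx_sym. Qed.

Let sGi t : 0 <= t <= T -> (invmx (G t))^T = invmx (G t).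
Proof. by move=> tT; rewrite trmx_inv sG. Qed.

Let sQ t : 0 <= t <= T -> (Q t)^T = Q t.
Proof. by move=> /symN/ulsubmx_sym. Qed.

Let cQ : mxcont T Q.
Proof.
move=> i j; apply: (@within_ext R T (fun t => N t (lshift nw i) (lshift nw j))) => //.
by move=> t _; rewrite /Q !mxE.
Qed.

Let cS : mxcont T S.
Proof.
move=> i j; apply: (@within_ext R T (fun t => N t (lshift nw i) (rshift n j))) => //.
by move=> t _; rewrite /S !mxE.
Qed.

Let cG : mxcont T G.
Proof.
move=> i j; apply: (@within_ext R T (fun t => N t (rshift n i) (rshift n j))) => //.
by move=> t _; rewrite /G !mxE.
Qed.

Let cGi : mxcont T (fun t => invmx (G t)). Proof. exact: mxcont_invmx. Qed.

(** Pontryagin's system for state x and costate p, with p' = - (Q x + S w) - A^T p, after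
    eliminating w by the stationarity condition S^T x + B^T p + G w = 0. *)
Let ham t : 'M[R]_(n + n) := block_mx
  (A t - B t *m invmx (G t) *m (S t)^T) (- (B t *m invmx (G t) *m (B t)^T))
  (S t *m invmx (G t) *m (S t)^T - Q t) (- (A t - B t *m invmx (G t) *m (S t)^T)^T).

Let cham : mxcont T ham.
Proof.
have cF : mxcont T (fun t => A t - B t *m invmx (G t) *m (S t)^T).
  by apply: mxcontD => //; apply: mxcontN; apply: mxcontM; [exact: mxcontM|exact: mxcont_tr].
apply: (@mxcontinuous_block R (subspace `[0, T])) => //.
- by apply: mxcontN; apply: mxcontM; [exact: mxcontM|exact: mxcont_tr].
- by apply: mxcontD; [apply: mxcontM; [exact: mxcontM|exact: mxcont_tr]|exact: mxcontN].
- by apply: mxcontN; exact: mxcont_tr.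
Qed.

(* The invariant U^T V - V^T U = 0 makes V U^-1 symmetric. *)
Let hamiltonian_flow : exists U V : R -> 'M[R]_n, [/\ U T = 1%:M, V T = 0,
  forall t, 0 <= t <= T ->
    is_mxderive U t ((A t - B t *m invmx (G t) *m (S t)^T) *m U t
              - B t *m invmx (G t) *m (B t)^T *m V t),
  forall t, 0 <= t <= T ->
    is_mxderive V t ((S t *m invmx (G t) *m (S t)^T - Q t) *m U t
              - (A t - B t *m invmx (G t) *m (S t)^T)^T *m V t) &
  forall t, (U t)^T *m V t = (V t)^T *m U t].
Proof.
have [a aP] := mxcont_bounded T0 cham.
have chc i j : continuous (fun t => ham (clamp T t) i j).
  exact: (continuous_clamp T0 (@cham i j)).
have bhc t i j : `|ham (clamp T t) i j| <= a by apply: aP; exact: clamp_in.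
have [X [XT dX]] := linear_ode T (col_mx 1%:M 0 : 'M[R]_(n + n, n)) chc bhc.
pose U t := usubmx (X t); pose V t := dsubmx (X t).
have XE t : X t = col_mx (U t) (V t) by rewrite vsubmxK.
have dU t : is_mxderive U t (usubmx (ham (clamp T t) *m X t)).
  by move=> i j; rewrite mxE; under eq_fun do rewrite mxE; exact: dX.
have dV t : is_mxderive V t (dsubmx (ham (clamp T t) *m X t)).
  by move=> i j; rewrite mxE; under eq_fun do rewrite mxE; exact: dX.
have {}dU t : is_mxderive U t
    ((A (clamp T t) - B (clamp T t) *m invmx (G (clamp T t)) *m (S (clamp T t))^T) *m U t
     - B (clamp T t) *m invmx (G (clamp T t)) *m (B (clamp T t))^T *m V t).
  by have := dU t; rewrite /ham XE mul_block_col col_mxKu mulNmx.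
have {}dV t : is_mxderive V t
    ((S (clamp T t) *m invmx (G (clamp T t)) *m (S (clamp T t))^T - Q (clamp T t)) *m U t
     - (A (clamp T t) - B (clamp T t) *m invmx (G (clamp T t)) *m (S (clamp T t))^T)^T *m V t).
  by have := dV t; rewrite /ham XE mul_block_col col_mxKd mulNmx.
exists U, V; split.
- by rewrite /U XT col_mxKu.
- by rewrite /V XT col_mxKd.
- by move=> t tT; have := dU t; rewrite clamp_id.
- by move=> t tT; have := dV t; rewrite clamp_id.
pose W t := (U t)^T *m V t - (V t)^T *m U t.
have dW t : is_mxderive W t 0.
  have := is_mxderiveD (is_mxderiveM (is_mxderive_tr (dU t)) (dV t))
    (is_mxderiveN (is_mxderiveM (is_mxderive_tr (dV t)) (dU t))).
  set c := clamp T t; have cT : 0 <= c <= T by exact: clamp_in.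
  rewrite /W (_ : _ + _ = 0)//.
  rewrite !(trmx_add, trmx_opp, trmx_mul, trmxK).
  rewrite !sGi// sQ//.
  rewrite !(mulmxDl, mulmxDr, mulmxBl, mulmxBr, mulNmx, mulmxN) !mulmxA.
  rewrite !opprD !opprK.
  by mx_ring.
have W0 t : W t = W T.
  apply/matrixP => i j; apply: (@is_derive_0_is_cst _ (fun s => W s i j)) => s.
  by have := dW s i j; rewrite [X in is_derive _ _ _ X]mxE.
move=> t; apply/eqP; rewrite -subr_eq0; apply/eqP; rewrite -/(W t) W0 /W.
by rewrite /U /V XT col_mxKu col_mxKd mulmx0 trmx0 mul0mx subrr.
Qed.

(* If U(t0) v = 0 then x = U v, p = V v satisfy x(t0) = 0, p(T) = 0, and
   x^T P x - p^T x decreases strictly wherever x <> 0 because p^T x is minus an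
   antiderivative of the running cost; this contradicts P(T) >= 0. *)
Let flow_unitmx P U V t0 : feasible N P ->
  U T = 1%:M -> V T = 0 ->
  (forall t, 0 <= t <= T ->
    is_mxderive U t ((A t - B t *m invmx (G t) *m (S t)^T) *m U t
              - B t *m invmx (G t) *m (B t)^T *m V t)) ->
  (forall t, 0 <= t <= T ->
    is_mxderive V t ((S t *m invmx (G t) *m (S t)^T - Q t) *m U t
              - (A t - B t *m invmx (G t) *m (S t)^T)^T *m V t)) ->
  0 <= t0 <= T -> U t0 \in unitmx.
Proof.
move=> [dP sP psdP lmiP] UT VT dU dV t0T; have /andP[t00 t0T'] := t0T.
have [//|] := boolP (U t0 \in unitmx).
rewrite unitmxE unitfE negbK -det_tr => /det0P[v' v'0 vU].
pose v := v'^T.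
have v0 : v != 0 by rewrite -trmx0 (inj_eq trmx_inj).
have Uv : U t0 *m v = 0 by rewrite -[U t0]trmxK -trmx_mul vU trmx0.
pose x t := U t *m v; pose p t := V t *m v.
pose w t := - (invmx (G t) *m ((S t)^T *m x t + (B t)^T *m p t)).
have dx t : 0 <= t <= T -> is_mxderive x t (A t *m x t + B t *m w t).
  move=> tT; have := is_mxderiveM (dU t tT) (is_mxderive_cst v t).
  rewrite mulmx0 addr0 -[X in is_mxderive _ _ X]/(_ *m v).
  rewrite (_ : _ *m v = A t *m x t + B t *m w t)//.
  by rewrite /x /p /w mulmxN !mulmxDr opprD !mulmxBl !mulmxA addrA.
have dp t : 0 <= t <= T ->
    is_mxderive p t (- (Q t *m x t + S t *m w t) - (A t)^T *m p t).
  move=> tT; have := is_mxderiveM (dV t tT) (is_mxderive_cst v t).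
  rewrite mulmx0 addr0.
  rewrite (_ : _ *m v = - (Q t *m x t + S t *m w t) - (A t)^T *m p t)//.
  rewrite /x /p /w mulmxN !mulmxDr !(trmx_add, trmx_opp, trmx_mul, trmxK) sGi//.
  rewrite !mulmxBl !mulmxA.
  by mx_ring.
have Gw t : 0 <= t <= T -> G t *m w t = - ((S t)^T *m x t + (B t)^T *m p t).
  by move=> tT; rewrite /w mulmxN mulKVmx ?uG.
have xt0 : x t0 = 0 by [].
have xT : x T = v by rewrite /x UT mul1mx.
have pT : p T = 0 by rewrite /p VT mul0mx.
clearbody w x p.
pose h t := bf (p t) 1%:M (x t) - bf (x t) (P t) (x t).
have dh t : 0 <= t <= T -> is_derive t 1 h (- qf (lmi N P t) (col_mx (x t) (w t))).
  move=> tT; have dPt : is_mxderive P t (mxderive P t).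
    by apply/is_mxderiveP; split => //; exact: dP.
  have := is_deriveB (is_derive_bf (dp t tT) (is_mxderive_cst 1%:M t) (dx t tT))
    (is_derive_bf (dx t tT) dPt (dx t tT)).
  move=> /is_derive_eq; apply.
  rewrite bf0m /lmi qf_lmi ?symN ?sP// qf_sym_block ?symN//.
  rewrite -/(Q t) -/(S t) -/(G t).
  (* Stationarity trades w^T G w for cross terms; this makes the derivative of p^T x equal to minus
     the running cost. *)
  have wG : bf (w t) (G t) (w t) = - bf (w t) (S t)^T (x t) - bf (p t) (B t) (w t).
    rewrite -[G t]mul1mx bf_mulr Gw// bfNr bfDr -!bf_mulr !mul1mx.
    by rewrite (bf_tr (w t) (B t)^T) trmxK opprD.
  rewrite wG (bf_sym (A t *m x t + B t *m w t) _ (sP t tT)) -bf_tr.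
  rewrite !bfDl !bfDr !bfNl !bfDl !bf_mul1l !bf_mul1r !trmxK sQ//.
  rewrite (bf_tr (x t) (S t)).
  by ring.
have F0 : h t0 = 0 by rewrite /h xt0 !bf0r subr0.
have FT : h T <= 0 by rewrite /h pT bf0l sub0r oppr_le0 xT; exact: psdP.
have lt0T : t0 < T.
  rewrite lt_neqAle t0T' andbT; apply: contra_neq v0 => t0E.
  by rewrite -Uv t0E UT mul1mx.
have TT : 0 <= T <= T by rewrite lexx ltW.
(* As x(T) = v is nonzero, the LMI is strict at T, so h is smaller than h(T) <= 0 at some z in (t0,
   T); but h is nondecreasing on [t0, z] and vanishes at t0. *)
have dT : 0 < - qf (lmi N P T) (col_mx (x T) (w T)).
  rewrite oppr_gt0; apply: lmiP => //; apply: contraNneq v0.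
  by rewrite -col_mx0 => /eq_col_mx[+ _]; rewrite xT => ->.
have [z [/andP[t0z zT] hz]] := derive_gt0_left (dh T TT) dT lt0T.
have : h t0 <= h z.
  apply: derive_ge0_homo (ltW t0z) => s /andP[t0s sz].
  have sT : 0 <= s <= T by rewrite (le_trans t00)//= (le_trans sz)// ltW.
  exists (- qf (lmi N P s) (col_mx (x s) (w s))); first exact: dh.
  rewrite oppr_ge0; have [->|nz] := eqVneq (col_mx (x s) (w s)) 0.
    by rewrite qfE bf0r.
  by apply: ltW; exact: lmiP.
by rewrite F0 leNgt => /negP; case; exact: lt_le_trans hz FT.
Qed.

(** Only the derivability of V U^-1 is proved directly; the value of its derivative follows by
    differentiating Y U = V and cancelling U. The same relation turns the equation of U into U' = (A
    - B K) U, so the closed-loop trajectory from e is U U(0)^-1 e and no second equation has to be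
    solved. *)
Lemma riccati_exists P e : feasible N P -> exists Y dY (xs : R -> 'cV[R]_n),
  [/\ riccati N Y dY, Y T = 0, forall t, 0 <= t <= T -> (Y t)^T = Y t, xs 0 = e &
   forall t, 0 <= t <= T -> is_mxderive xs t ((A t - B t *m gain N Y t) *m xs t)].
Proof.
move=> fP; have [U [V [UT VT dU dV UV]]] := hamiltonian_flow.
have uU t : 0 <= t <= T -> U t \in unitmx by exact: flow_unitmx fP UT VT dU dV.
pose Y t := V t *m invmx (U t).
have YU t : 0 <= t <= T -> Y t *m U t = V t by move=> /uU ut; rewrite /Y mulmxKV.
have sY t : 0 <= t <= T -> (Y t)^T = Y t.
  move=> /uU ut; rewrite /Y trmx_mul trmx_inv.
  have uUt : (U t)^T \in unitmx by rewrite unitmx_tr.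
  apply: (can_inj (mulKmx uUt)); rewrite mulKVmx// mulmxA UV.
  by rewrite mulmxK.
pose dY t := mxderive Y t.
have dYt t : 0 <= t <= T -> is_mxderive Y t (dY t).
  move=> tT; apply/is_mxderiveP; split => //.
  have di : mxderivable (fun s => invmx (U s)) t.
    by apply: mxderivable_invmx; [case/is_mxderiveP: (dU t tT)|exact: uU].
  have di' : is_mxderive (fun s => invmx (U s)) t (mxderive (fun s => invmx (U s)) t).
    by apply/is_mxderiveP.
  by case/is_mxderiveP: (is_mxderiveM (dV t tT) di').
(* Comparing two-sided derivatives requires Y U = V around t, also at the end points; invertibility,
   known on [0, T], persists on a neighbourhood. *)
have nYU t : 0 <= t <= T -> \forall s \near t, Y s *m U s = V s.
  move=> tT; have := unitmx_near (dU t tT) (uU t tT).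
  by apply: filterS => s us; rewrite /Y mulmxKV.
have YT : Y T = 0 by rewrite /Y VT mul0mx.
clearbody Y.
have T00 : 0 <= (0 : R) <= T by rewrite lexx ltW.
exists Y, dY, (fun t => U t *m (invmx (U 0) *m e)); split => //.
- move=> t tT; split; first exact: dYt.
  have E := is_mxderiveM (dYt t tT) (dU t tT).
  have E2 : is_mxderive V t (dY t *m U t + Y t *m ((A t - B t *m invmx (G t) *m (S t)^T) *m U t
              - B t *m invmx (G t) *m (B t)^T *m V t)).
    move=> i j; apply: near_eq_is_derive (E i j).
    by apply: filterS (nYU t tT) => s ->.
  have {E2}E := is_mxderive_uniq (dV t tT) E2.
  apply: (can_inj (mulmxK (uU t tT))); rewrite mul0mx.
  rewrite /riccati_res /gain -/(S t) -/(Q t) -/(G t).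
  move: E; rewrite -(YU t tT) => E.
  have {}E : dY t *m U t = (S t *m invmx (G t) *m (S t)^T - Q t) *m U t -
    (A t - B t *m invmx (G t) *m (S t)^T)^T *m (Y t *m U t) -
    Y t *m ((A t - B t *m invmx (G t) *m (S t)^T) *m U t -
      B t *m invmx (G t) *m (B t)^T *m (Y t *m U t)) by rewrite E addrK.
  rewrite !mulmxDl E.
  rewrite !(trmx_add, trmx_opp, trmx_mul, trmxK) sGi// sY//.
  rewrite !(mulmxDl, mulmxDr, mulNmx, mulmxN, mulmxA).
  by mx_ring.
- by rewrite mulmxA mulmxV ?mul1mx// uU.
move=> t tT; have := is_mxderiveM (dU t tT) (is_mxderive_cst (invmx (U 0) *m e) t).
rewrite mulmx0 addr0; congr (is_mxderive _ t _).
rewrite mulmxA; congr (_ *m _).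
rewrite -YU// /gain -/(S t) -/(G t) !(trmx_add, trmx_mul) sY//.
rewrite !(mulmxDl, mulmxDr, mulNmx, mulmxN, mulmxA).
by mx_ring.
Qed.

End LinearQuadratic.

(** * Feasible perturbations and smooth trajectories *)

Section ValueFunction.
Context {R : realType}.
Variables (n nw : nat) (T : R).
Hypothesis T0 : 0 < T.
Variables (A : R -> 'M[R]_n) (B : R -> 'M[R]_(n, nw)).
Hypotheses (cA : mxcont T A) (cB : mxcont T B).
Implicit Types (N : R -> 'M[R]_(n + nw)) (P Y : R -> 'M[R]_n).

Lemma derive0_cst (F : R -> R) (a b : R) : a <= b ->
  (forall t, a <= t <= b -> is_derive t (1 : R) F 0) -> F a = F b.
Proof.
move=> ab dF; apply/eqP; rewrite eq_le; apply/andP; split.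
  by apply: derive_ge0_homo => // t /dF dFt; exists 0.
rewrite -lerN2; apply: (@derive_ge0_homo _ (fun s => - F s)) => // t /dF dFt.
by exists (- 0); [exact: is_deriveN|rewrite oppr0].
Qed.

(* D' = -(A^T D + D A) is solved by D = Phi^-T D(T) Phi^-1, Phi' = A Phi. *)
Lemma lyapunov_uniq (D dD : R -> 'M[R]_n) : D T = 0 ->
  (forall t, 0 <= t <= T -> is_mxderive D t (dD t)) ->
  (forall t, 0 <= t <= T -> dD t + (A t)^T *m D t + D t *m A t = 0) ->
  forall t, 0 <= t <= T -> D t = 0.
Proof.
move=> DT dDt eqD.
have [a aP] := mxcont_bounded T0 cA.
have cAc i j : continuous (fun t => A (clamp T t) i j).
  exact: (continuous_clamp T0 (@cA i j)).
have bAc t i j : `|A (clamp T t) i j| <= a by apply: aP; exact: clamp_in.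
have [U [UT dU]] := linear_ode T (1%:M : 'M[R]_n) cAc bAc.
have cAt i j : continuous (fun t => (- (A (clamp T t))^T) i j).
  by under eq_fun do rewrite !mxE; apply: continuous_oppr; exact: cAc.
have bAt t i j : `|(- (A (clamp T t))^T) i j| <= a by rewrite !mxE normrN.
have [W [WT dW]] := linear_ode T (1%:M : 'M[R]_n) cAt bAt.
have WU t : (W t)^T *m U t = 1%:M.
  have dWU s : is_mxderive (fun s => (W s)^T *m U s) s 0.
    have := is_mxderiveM (is_mxderive_tr (dW s)) (dU s).
    rewrite (_ : _ + _ = 0)// trmx_mul trmx_opp trmxK mulmxN mulNmx mulmxA.
    by rewrite addrC subrr.
  transitivity ((W T)^T *m U T); last by rewrite WT UT trmx1 mulmx1.
  apply/matrixP => i j.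
  apply: (@is_derive_0_is_cst _ (fun s => ((W s)^T *m U s) i j)) => s.
  by have := dWU s i j; rewrite [X in is_derive _ _ _ X]mxE.
have UW t : U t *m (W t)^T = 1%:M by exact: mulmx1C.
have Z t : 0 <= t <= T -> (U t)^T *m D t *m U t = 0.
  move=> tT; have /andP[t0 tT'] := tT.
  transitivity ((U T)^T *m D T *m U T); last by rewrite DT mulmx0 mul0mx.
  apply/matrixP => i j.
  apply: (@derive0_cst (fun s => ((U s)^T *m D s *m U s) i j)) => // s /andP[ts sT].
  have s0T : 0 <= s <= T by rewrite (le_trans t0).
  have := is_mxderiveM (is_mxderiveM (is_mxderive_tr (dU s)) (dDt s s0T)) (dU s).
  rewrite clamp_id//.
  rewrite (_ : _ + _ = (U s)^T *m (dD s + (A s)^T *m D s + D s *m A s) *m U s).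
    by rewrite eqD// mulmx0 mul0mx => /(_ i j); rewrite [X in is_derive _ _ _ X]mxE.
  rewrite trmx_mul !(mulmxDl, mulmxDr) !mulmxA.
  by mx_ring.
move=> t tT; have WUW : W t *m (U t)^T = 1%:M.
  by rewrite -[W t]trmxK -trmx_mul UW trmx1.
have -> : D t = W t *m ((U t)^T *m D t *m U t) *m (W t)^T.
  by rewrite !mulmxA WUW mul1mx -mulmxA UW mulmx1.
by rewrite Z// mulmx0 mul0mx.
Qed.

Variable N : R -> 'M[R]_(n + nw).
Hypotheses (cN : mxcont T N)
  (symN : forall t, 0 <= t <= T -> (N t)^T = N t)
  (negN : forall t, 0 <= t <= T -> negdef (drsubmx (N t))).

(** The quadratic term L R^-1 L^T is symmetric whatever [Y] is, so it cancels from the residual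
    minus its transpose, and D = Y - Y^T solves the linear equation of [lyapunov_uniq]. *)
Lemma riccati_sym Y dY : riccati T A B N Y dY -> Y T = 0 ->
  forall t, 0 <= t <= T -> (Y t)^T = Y t.
Proof.
move=> ricY YT t tT; apply/esym/eqP; rewrite -subr_eq0; apply/eqP.
apply: (@lyapunov_uniq (fun s => Y s - (Y s)^T) (fun s => dY s - (dY s)^T)) tT.
- by rewrite YT trmx0 subrr.
- move=> s /ricY[dYs _]; apply: is_mxderiveD => //; apply: is_mxderiveN.
  exact: is_mxderive_tr.
move=> s sT; have [_ E] := ricY s sT.
have <- : riccati_res A B N Y dY s - (riccati_res A B N Y dY s)^T = 0.
  by rewrite E trmx0 subrr.
rewrite /riccati_res /gain.
set L := Y s *m B s + _; set Gi := invmx _.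
have sGi : Gi^T = Gi by rewrite /Gi trmx_inv drsubmx_sym// symN.
have sQ : (ulsubmx (N s))^T = ulsubmx (N s) by rewrite ulsubmx_sym// symN.
clearbody L Gi.
rewrite !(trmx_add, trmx_opp, trmx_mul, trmxK) sGi sQ.
rewrite !(mulmxDl, mulmxDr, mulNmx, mulmxN) !mulmxA.
by mx_ring.
Qed.

Lemma bf1_gt0 k (x : 'cV[R]_k) : x != 0 -> 0 < bf x 1%:M x.
Proof.
move=> x0; have E : bf x 1%:M x = \sum_i x i 0 ^+ 2.
  by rewrite /bf mulmx1 mxE; apply: eq_bigr => i _; rewrite mxE expr2.
rewrite lt_neqAle E sumr_ge0 ?andbT//; last by move=> i _; exact: sqr_ge0.
apply: contra x0 => /eqP/esym/eqP; rewrite psumr_eq0; last by move=> i _; exact: sqr_ge0.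
move=> /allP H; apply/eqP/colP => i; rewrite mxE; apply/eqP.
by rewrite -sqrf_eq0; apply: H; rewrite mem_index_enum.
Qed.

Lemma mxcont_ursubmx : mxcont T (fun t => ursubmx (N t)).
Proof.
move=> i j; apply: (@within_ext R T (fun t => N t (lshift nw i) (rshift n j))) => //.
by move=> t _; rewrite !mxE.
Qed.

Lemma mxcont_ulsubmx : mxcont T (fun t => ulsubmx (N t)).
Proof.
move=> i j; apply: (@within_ext R T (fun t => N t (lshift nw i) (lshift nw j))) => //.
by move=> t _; rewrite !mxE.
Qed.

Lemma mxcont_invdrsubmx : mxcont T (fun t => invmx (drsubmx (N t))).
Proof.
apply: mxcont_invmx; first by move=> t /negN/negdef_unitmx.
move=> i j; apply: (@within_ext R T (fun t => N t (rshift n i) (rshift n j))) => //.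
by move=> t _; rewrite !mxE.
Qed.

Lemma mxcont_gain Y : mxcont T Y -> mxcont T (gain B N Y).
Proof.
move=> cY; apply: mxcontM; first exact: mxcont_invdrsubmx.
apply: mxcont_tr; apply: mxcontD; last exact: mxcont_ursubmx.
exact: mxcontM.
Qed.

Lemma riccati_mxcont Y dY : riccati T A B N Y dY -> mxcont T Y.
Proof. by move=> ricY; apply: (@mxcont_derivable R T _ _ Y dY) => t /ricY[]. Qed.

(* Y + eta exp(-c t) I is strictly feasible for c large and eta <= 1. *)
Lemma riccati_feasible Y dY (e : 'cV[R]_n) (eps : R) :
  riccati T A B N Y dY -> Y T = 0 -> 0 < eps ->
  exists2 P, feasible T A B N P & qf (P 0) e <= qf (Y 0) e + eps.
Proof.
move=> ricY YT eps0; have sY := riccati_sym ricY YT.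
have cY := riccati_mxcont ricY.
pose F t := A t - B t *m gain B N Y t.
pose H t := B t *m invmx (drsubmx (N t)) *m (B t)^T.
have cF : mxcont T (fun t => F t + (F t)^T).
  have cF : mxcont T F.
    by apply: mxcontD => //; apply: mxcontN; apply: mxcontM => //; exact: mxcont_gain.
  by apply: mxcontD => //; exact: mxcont_tr.
have cH : mxcont T H.
  apply: mxcontM; last exact: mxcont_tr.
  by apply: mxcontM => //; exact: mxcont_invdrsubmx.
have [a aP] := mxcont_bounded T0 cF; have [b bP] := mxcont_bounded T0 cH.
(* By [qf_entries_le] the first two summands dominate the forms of F + F^T and H; the final 1 leaves
   a strict margin. *)
pose c := n%:R * `|a| + n%:R * `|b| + 1.
have c0 : 0 < c by rewrite ltr_wpDl// addr_ge0// mulr_ge0.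
pose ee := bf e 1%:M e.
have ee0 : 0 <= ee.
  by rewrite /ee; have [->|/bf1_gt0/ltW//] := eqVneq e 0; rewrite bf0l.
(* The bound 1 keeps [phi] below 1, so its square costs no more than H itself; the other bound makes
   eta e^T e at most eps, with + 1 guarding against e = 0. *)
pose eta := Num.min 1 (eps / (ee + 1)).
have eta0 : 0 < eta by rewrite lt_min ltr01 divr_gt0// ltr_wpDl.
have eta1 : eta <= 1 by rewrite ge_min lexx.
have etaee : eta * ee <= eps.
  apply: (@le_trans _ _ (eps / (ee + 1) * ee)).
    by rewrite ler_wpM2r// ge_min lexx orbT.
  by rewrite mulrAC ler_pdivrMr ?ltr_wpDl// ler_wpM2l ?(ltW eps0)// lerDl.
pose phi (t : R) := eta * expR (- (c * t)).
have phi0 t : 0 < phi t by rewrite mulr_gt0// expR_gt0.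
have phi1 t : 0 <= t -> phi t <= 1.
  move=> t0; rewrite /phi -[leRHS]mulr1 ler_pM ?expR_ge0//; first exact: ltW.
  by rewrite -expR0 ler_expR oppr_le0 mulr_ge0// ltW.
have dphi (t : R) : is_derive t 1 phi (- c * phi t).
  have dl : is_derive t 1 (fun s => c * s) c.
    have := is_derive_mulr (is_derive_cst c t 1) (is_derive_id t 1).
    by rewrite mul0r add0r mulr1.
  have := is_derive_mulr (is_derive_cst eta t 1)
     (is_derive1_comp (is_derive_expR _) (is_deriveN dl)).
  by move=> /is_derive_eq; apply; rewrite /phi /cst /=; ring.
have P0 : phi 0 = eta by rewrite /phi mulr0 oppr0 expR0 mulr1.
clearbody phi.
pose P t := Y t + phi t *: 1%:M.
pose dP t := dY t + (- c * phi t) *: 1%:M.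
have dPt t : 0 <= t <= T -> is_mxderive P t (dP t).
  move=> /ricY[dYt _]; apply: is_mxderiveD => //.
  by have := is_mxderiveZ (dphi t) (is_mxderive_cst (1%:M : 'M[R]_n) t); rewrite scaler0 addr0.
have sP t : 0 <= t <= T -> (P t)^T = P t.
  by move=> tT; rewrite /P trmx_add sY// linearZ/= trmx1.
pose E t := riccati_res A B N P dP t.
(* Expansion of the residual in powers of [phi]: order 0 is the Riccati equation of [Y], order 1
   brings the closed-loop matrix F, order 2 is the term in H. *)
have EE t : 0 <= t <= T ->
    E t = phi t *: (- (c *: 1%:M) + (F t + (F t)^T) - phi t *: H t).
  move=> tT; have [_ r0] := ricY t tT.
  rewrite -[LHS]subr0 -r0 /E /F /H /riccati_res /P /dP /gain.
  set S := ursubmx _; set Gi := invmx _.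
  have sGi : Gi^T = Gi by rewrite /Gi trmx_inv drsubmx_sym// symN.
  have sYt := sY t tT.
  rewrite !(trmx_add, trmx_opp, trmx_mul, trmx_scale, trmxK, trmx1) sGi sYt.
  rewrite !(mulmxDl, mulmxDr, mulNmx, mulmxN, mulmxA).
  rewrite -!(scalemxAl, scalemxAr) !(mul1mx, mulmx1).
  move: 1%:M => I1.
  by mx_ring.
clearbody F H.
have dEP t : 0 <= t <= T -> mxderive P t = dP t.
  by move=> /dPt/is_mxderiveP[].
have T00 : 0 <= (0 : R) <= T by rewrite lexx ltW.
exists P; last first.
  rewrite /P qfE bfDm bfZm P0 -/ee -qfE.
  by rewrite lerD2l.
split => //.
- by move=> t tT; have /is_mxderiveP[] := dPt t tT.
- move=> v; rewrite /P YT add0r qfE bfZm mulr_ge0 ?(ltW (phi0 _))//.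
  by have [->|/bf1_gt0/ltW//] := eqVneq v 0; rewrite bf0l.
move=> t tT v v0; rewrite -[v]vsubmxK; set x := usubmx v; set w := dsubmx v.
have nG := negN tT; have uG := negdef_unitmx nG.
rewrite /lmi dEP// qf_lmi ?symN ?sP//.
rewrite (@riccati_square R n nw (A t) (B t) (N t) (symN tT) (P t) (dP t) (E t) x w
  (sP t tT) uG erefl).
set z := w + _.
have qG : qf (drsubmx (N t)) z <= 0.
  by have [->|/nG/ltW//] := eqVneq z 0; rewrite qfE bf0l.
(* Strictness comes from R < 0 when x = 0, since then z = w is nonzero, and from the residual E
   otherwise. *)
have [x0|x0] := eqVneq x 0.
  rewrite x0 bf0l add0r; apply: nG; rewrite /z x0 mulmx0 addr0.
  apply: contraNneq v0 => w0.
  by rewrite -[v]vsubmxK -/x -/w x0 w0 col_mx0.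
suff : bf x (E t) x < 0 by move=> ?; rewrite -[ltRHS]addr0; exact: ltr_leD.
rewrite EE// bfZm pmulr_rlt0 ?phi0// !bfDm !bfNm !bfZm.
have xx := bf1_gt0 x0.
have := qf_entries_le x (aP t tT); have := qf_entries_le x (bP t tT).
rewrite !qfE bfDm !ler_norml => /andP[h2 _] /andP[_ h1].
have ale : n%:R * a * bf x 1%:M x <= n%:R * `|a| * bf x 1%:M x.
  by rewrite ler_wpM2r ?(ltW xx)// ler_wpM2l// ler_norm.
have ble : n%:R * b * bf x 1%:M x <= n%:R * `|b| * bf x 1%:M x.
  by rewrite ler_wpM2r ?(ltW xx)// ler_wpM2l// ler_norm.
have b0 : 0 <= n%:R * `|b| * bf x 1%:M x by rewrite !mulr_ge0// ltW.
have h3 : - (phi t * bf x (H t) x) <= n%:R * `|b| * bf x 1%:M x.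
  rewrite -mulrN; apply: (@le_trans _ _ (phi t * (n%:R * `|b| * bf x 1%:M x))).
    by rewrite ler_wpM2l ?(ltW (phi0 t))//; lra.
  by rewrite ler_piMl// phi1//; case/andP: tT.
by rewrite /c; lra.
Qed.

(** The accumulated cost plus x^T P x has the LMI form as derivative, and P(T) >= 0 discards the
    final term. The weight N' is independent of how the pair arose: it is taken at [lam] to compare
    [Y] with P, and at [alpha] for the subgradient inequality. *)
Lemma smooth_cost_le (N' : R -> 'M[R]_(n + nw)) P (x : R -> 'cV[R]_n) (w : R -> 'cV[R]_nw) :
  mxcont T N' -> (forall t, 0 <= t <= T -> (N' t)^T = N' t) ->
  feasible T A B N' P -> mxcont T w ->
  (forall t, 0 <= t <= T -> is_mxderive x t (A t *m x t + B t *m w t)) ->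
  Defs.Rint 0 T (fun t => qf (N' t) (col_mx (x t) (w t))) <= qf (P 0) (x 0).
Proof.
move=> cN' sN' [dP sP psdP lmiP] cw dx.
have cx : mxcont T x.
  by apply: (@mxcont_derivable R T _ _ x (fun t => A t *m x t + B t *m w t)) => t /dx.
pose f t := qf (N' t) (col_mx (x t) (w t)).
have cf : {within `[0, T], continuous f}.
  have cxw := @mxcontinuous_col R (subspace `[0, T]) _ _ _ x w cx cw.
  exact: (@continuous_bf R (subspace `[0, T]) _ _ _ _ _ cxw cN' cxw).
have [I dI] := antiderivative (continuous_clamp T0 cf).
have dIf t : 0 <= t <= T -> is_derive t 1 I (f t).
  by move=> tT; have := dI t; rewrite clamp_id.
rewrite (Rint_derive (ltW T0) cf dIf).
have : - (I 0 + bf (x 0) (P 0) (x 0)) <= - (I T + bf (x T) (P T) (x T)).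
  apply: (@derive_ge0_homo R (fun s => - (I s + bf (x s) (P s) (x s)))) (ltW T0) => t tT.
  have dPt : is_mxderive P t (mxderive P t) by apply/is_mxderiveP; split => //; exact: dP.
  have := is_deriveN (is_derive_addr (dIf t tT) (is_derive_bf (dx t tT) dPt (dx t tT))).
  move=> hd; eexists; first exact: hd.
  rewrite [X in 0 <= X](_ : _ = - qf (lmi A B N' P t) (col_mx (x t) (w t))); last first.
    rewrite /lmi qf_lmi ?sP// /f (bf_sym (_ + _) _ (sP t tT)).
    by ring.
  rewrite oppr_ge0; have [->|nz] := eqVneq (col_mx (x t) (w t)) 0.
    by rewrite qfE bf0r.
  by apply: ltW; exact: lmiP.
have := psdP (x T); rewrite !qfE.
lra.
Qed.

End ValueFunction.

(** * The cost of square integrable inputs *)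

Section SquareIntegrable.
Context {R : realType}.
Variable T : R.
Hypothesis T0 : 0 < T.
Implicit Types f g : R -> R.

Definition sqL1 f := measurable_fun (`[0, T] : set (measurableTypeR R)) f /\
  L1 T (fun t => f t ^+ 2).

Lemma sqL1M f g : sqL1 f -> sqL1 g -> L1 T (fun t => f t * g t).
Proof.
move=> [mf fi] [mg gi].
have := L1D fi gi; apply: le_integrable => //.
  by apply/measurable_EFinP; exact: measurable_funM.
move=> x _ /=; rewrite lee_fin normrM (ger0_norm (addr_ge0 (sqr_ge0 _) (sqr_ge0 _))).
rewrite -(real_normK (num_real (f x))) -(real_normK (num_real (g x))).
have := sqr_ge0 (`|f x| - `|g x|); rewrite sqrrB.
have : 0 <= `|f x| * `|g x| by rewrite mulr_ge0.
lra.
Qed.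

Lemma sqL1_continuous f : {within `[0, T], continuous f} -> sqL1 f.
Proof.
move=> cf; split; first exact: subspace_continuous_measurable_fun.
by apply: L1_continuous; exact: (@continuous_mulr R (subspace `[0, T])).
Qed.

Lemma sqL1_L1 f : sqL1 f -> L1 T f.
Proof.
move=> sf; apply: (@L1_ext R T (fun t => f t * 1)) => [t _|]; first by rewrite mulr1.
apply: sqL1M sf (sqL1_continuous _).
exact: (@continuous_cstr R (subspace `[0, T])).
Qed.

Lemma L1_bf k (x y : R -> 'cV[R]_k) (M : R -> 'M[R]_k) : mxcont T M ->
  (forall i, sqL1 (fun t => x t i 0)) -> (forall i, sqL1 (fun t => y t i 0)) ->
  L1 T (fun t => bf (x t) (M t) (y t)).
Proof.
move=> cM sx sy; under eq_fun do rewrite bf_sum.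
apply: L1_sum => i _; apply: L1_sum => j _.
apply: (@L1_ext R T (fun t => M t i j * (x t i 0 * y t j 0))).
  by move=> t _; rewrite mulrA (mulrC (x t i 0)).
by apply: L1M => //; exact: sqL1M.
Qed.

Lemma L1_mulmx p k (M : R -> 'M[R]_(p, k)) (x : R -> 'cV[R]_k) i : mxcont T M ->
  (forall i, L1 T (fun t => x t i 0)) -> L1 T (fun t => (M t *m x t) i 0).
Proof.
move=> cM xi; under eq_fun do rewrite mxE.
by apply: L1_sum => j _; exact: L1M.
Qed.

(** The product rule [isacM] is applied twice to each monomial of the double sum [bf_sum]. *)
Lemma isac_bf p q (x dx : R -> 'cV[R]_p) (M dM : R -> 'M[R]_(p, q))
    (y dy : R -> 'cV[R]_q) :
  (forall i, isac T (fun t => x t i 0) (fun t => dx t i 0)) ->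
  (forall i j, isac T (fun t => M t i j) (fun t => dM t i j)) ->
  (forall i, isac T (fun t => y t i 0) (fun t => dy t i 0)) ->
  isac T (fun t => bf (x t) (M t) (y t))
    (fun t => bf (dx t) (M t) (y t) + bf (x t) (dM t) (y t) + bf (x t) (M t) (dy t)).
Proof.
move=> ax aM ay.
have := isac_sum (fun i => isac_sum (fun j =>
  isacM T0 (isacM T0 (ax i) (aM i j)) (ay j))).
rewrite (_ : (fun s => \sum_i \sum_j x s i 0 * M s i j * y s j 0) =
  fun t => bf (x t) (M t) (y t)); last by apply/funext => s; rewrite bf_sum.
congr isac; apply/funext => s; rewrite !bf_sum -!big_split/=.
apply: eq_bigr => i _; rewrite -!big_split/=; apply: eq_bigr => j _.
by ring.
Qed.

End SquareIntegrable.

Section CostIdentity.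
Context {R : realType}.
Variables (n nw : nat) (T : R).
Hypothesis T0 : 0 < T.
Variables (A : R -> 'M[R]_n) (B : R -> 'M[R]_(n, nw)).
Hypotheses (cA : mxcont T A) (cB : mxcont T B).
Variable N : R -> 'M[R]_(n + nw).
Hypotheses (cN : mxcont T N)
  (symN : forall t, 0 <= t <= T -> (N t)^T = N t)
  (negN : forall t, 0 <= t <= T -> negdef (drsubmx (N t))).
Variables (Y dY : R -> 'M[R]_n).
Hypotheses (ricY : riccati T A B N Y dY) (YT : Y T = 0).

(** The Riccati equation expresses Y' through continuous data; [Y] is thus absolutely continuous
    with density Y', as the product rule for x^T Y x needs. *)
Lemma riccati_derive_mxcont : mxcont T dY.
Proof.
have cY := riccati_mxcont ricY.
pose Z t := - ((A t)^T *m Y t + Y t *m A t + ulsubmx (N t)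
  - (Y t *m B t + ursubmx (N t)) *m gain B N Y t).
have cZ : mxcont T Z.
  apply: mxcontN; apply: mxcontD; last first.
    apply: mxcontN; apply: mxcontM; last exact: mxcont_gain.
    by apply: mxcontD; [exact: mxcontM|exact: mxcont_ursubmx].
  apply: mxcontD; last exact: mxcont_ulsubmx.
  by apply: mxcontD; apply: mxcontM => //; exact: mxcont_tr.
move=> i j; apply: (@within_ext R T (fun t => Z t i j)) => // t tT.
have [_ E] := ricY tT; congr (fun_of_matrix _ i j).
apply/eqP; rewrite -subr_eq0 -oppr_eq0 opprB /Z opprK; apply/eqP.
by rewrite -E /riccati_res !addrA.
Qed.

Lemma cost_identity (x : R -> 'cV[R]_n) (w : R -> 'cV[R]_nw) (x0 : 'cV[R]_n) :
  L2fun T w -> mxcont T x ->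
  (forall t, 0 <= t <= T -> x t = x0 +
     \col_i Defs.Rint 0 t (fun s => (A s *m x s + B s *m w s) i 0)) ->
  Defs.Rint 0 T (fun t => qf (N t) (col_mx (x t) (w t))) =
  qf (Y 0) x0 +
  Defs.Rint 0 T (fun t => qf (drsubmx (N t)) (w t + gain B N Y t *m x t)).
Proof.
move=> L2w cx hx; have cY := riccati_mxcont ricY.
have sY := riccati_sym T0 cA symN ricY YT.
have T00 : 0 <= (0 : R) <= T by rewrite lexx ltW.
have TT : 0 <= T <= T by rewrite lexx ltW.
have sw i : sqL1 T (fun t => w t i 0) by have [mw wi] := L2w i.
have sx i : sqL1 T (fun t => x t i 0) by apply: sqL1_continuous => //; exact: cx.
pose dx t := A t *m x t + B t *m w t.
have dxi i : L1 T (fun t => dx t i 0).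
  rewrite /dx; under eq_fun do rewrite mxE.
  by apply: L1D; apply: L1_mulmx => // j; exact: sqL1_L1.
have ax i : isac T (fun t => x t i 0) (fun t => dx t i 0).
  split; [exact: cx|exact: dxi|].
  by move=> t tT; rewrite (hx t)// (hx 0)// !mxE Rint_itv0 addr0.
have aY i j : isac T (fun t => Y t i j) (fun t => dY t i j).
  apply: isac_derive => //; first exact: riccati_derive_mxcont.
  by move=> t /ricY[dYt _]; exact: dYt.
have [_ di hd] := isac_bf T0 ax aY ax.
(* As Y(T) = 0, this becomes 0 = x0^T Y(0) x0 + the integral of the density of x^T Y x. *)
have := hd T TT; rewrite {1}YT bf0m.
have x00 : x 0 = x0.
  by rewrite hx//; apply/colP => i; rewrite !mxE Rint_itv0 addr0.
rewrite x00 => E.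
set d := (fun t => _ + _ + _) in di E hd.
have sxw i : sqL1 T (fun t => col_mx (x t) (w t) i 0).
  rewrite (_ : (fun t => _) = fun t =>
    match fintype.split i with inl k => x t k 0 | inr k => w t k 0 end).
    by case: (fintype.split i).
  by apply/funext => t; rewrite mxE.
(* Needed to split the integral of the completed square into density and cost; it holds because x
   and w are square integrable and N is continuous. *)
have qi : L1 T (fun t => qf (N t) (col_mx (x t) (w t))) by exact: L1_bf.
have -> : Defs.Rint 0 T (fun t => qf (drsubmx (N t)) (w t + gain B N Y t *m x t)) =
    Defs.Rint 0 T (fun t => d t + qf (N t) (col_mx (x t) (w t))).
  apply: (Rint_ext TT) => t tT; have [_ E0] := ricY tT.
  have := @riccati_square R n nw (A t) (B t) (N t) (symN tT) (Y t) (dY t) 0 (x t) (w t)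
    (sY t tT) (negdef_unitmx (negN tT)) E0.
  rewrite bf0m add0r => <-.
  by rewrite /d (bf_sym (dx t) _ (sY t tT)) -/(dx t); ring.
by rewrite (Rint_add TT)// addrA -E add0r.
Qed.

End CostIdentity.

(** * The optimal pair *)

Section OptimalPair.
Context {R : realType}.
Variables (n nw : nat) (T : R).
Hypothesis T0 : 0 < T.
Variables (A : R -> 'M[R]_n) (B : R -> 'M[R]_(n, nw)).
Hypotheses (cA : mxcont T A) (cB : mxcont T B).
Variable N : R -> 'M[R]_(n + nw).
Hypotheses (cN : mxcont T N)
  (symN : forall t, 0 <= t <= T -> (N t)^T = N t)
  (negN : forall t, 0 <= t <= T -> negdef (drsubmx (N t))).
Variables (Y dY : R -> 'M[R]_n) (xs : R -> 'cV[R]_n) (e : 'cV[R]_n).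
Hypotheses (ricY : riccati T A B N Y dY) (YT : Y T = 0).
Hypotheses (xs0 : xs 0 = e)
  (dxs : forall t, 0 <= t <= T -> is_mxderive xs t ((A t - B t *m gain B N Y t) *m xs t)).

Definition feedback t : 'cV[R]_nw := - (gain B N Y t *m xs t).

Lemma feedback_derive t : 0 <= t <= T -> is_mxderive xs t (A t *m xs t + B t *m feedback t).
Proof. by move=> /dxs; rewrite mulmxBl /feedback mulmxN -mulmxA. Qed.

Lemma closed_loop_mxcont : mxcont T xs.
Proof.
apply: (@mxcont_derivable R T _ _ xs (fun t => A t *m xs t + B t *m feedback t)).
exact: feedback_derive.
Qed.

Lemma feedback_mxcont : mxcont T feedback.
Proof.
apply: mxcontN; apply: mxcontM; last exact: closed_loop_mxcont.
by apply: mxcont_gain => //; exact: riccati_mxcont ricY.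
Qed.

Lemma feedback_L2 : L2fun T feedback.
Proof.
by move=> i; have [] := sqL1_continuous (@feedback_mxcont i 0).
Qed.

Lemma feedback_integral t : 0 <= t <= T -> xs t = e +
  \col_i Defs.Rint 0 t (fun s => (A s *m xs s + B s *m feedback s) i 0).
Proof.
move=> tT; apply/colP => i; rewrite !mxE -xs0.
have cd : mxcont T (fun s => A s *m xs s + B s *m feedback s).
  by apply: mxcontD; apply: mxcontM => //; [exact: closed_loop_mxcont|exact: feedback_mxcont].
have := isac_derive (cd i 0) (fun s sT => feedback_derive sT i 0).
by move=> [_ _]; exact.
Qed.

Lemma feedback_cost :
  Defs.Rint 0 T (fun t => qf (N t) (col_mx (xs t) (feedback t))) = qf (Y 0) e.
Proof.
rewrite (cost_identity T0 cA cB cN symN negN ricY YT feedback_L2 closed_loop_mxcont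
  feedback_integral).
rewrite (@Rint_ext R T _ (fun=> 0)); first by rewrite /Defs.Rint Rintegral_cst// mul0r addr0.
  by rewrite lexx ltW.
by move=> s _; rewrite /feedback addNr qfE bf0r.
Qed.

Lemma cost_le_riccati (x : R -> 'cV[R]_n) (w : R -> 'cV[R]_nw) :
  L2fun T w -> mxcont T x ->
  (forall t, 0 <= t <= T -> x t = e +
     \col_i Defs.Rint 0 t (fun s => (A s *m x s + B s *m w s) i 0)) ->
  Defs.Rint 0 T (fun t => qf (N t) (col_mx (x t) (w t))) <= qf (Y 0) e.
Proof.
move=> L2w cx hx.
rewrite (cost_identity T0 cA cB cN symN negN ricY YT L2w cx hx) gerDl.
apply: Rint_le0 => t tT.
set z := _ + _; have [->|/(negN tT)/ltW//] := eqVneq z 0.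
by rewrite qfE bf0r.
Qed.

(** The left side is the cost of the feedback pair, and every feasible P bounds that cost. *)
Lemma riccati_le_feasible P : feasible T A B N P -> qf (Y 0) e <= qf (P 0) e.
Proof.
move=> fP; rewrite -feedback_cost -xs0.
exact: (smooth_cost_le T0 cN symN fP feedback_mxcont feedback_derive).
Qed.

End OptimalPair.

(** * The IQC weight as a function of the multiplier *)

Section IQC.
Context {R : realType}.
Variables (n nw nv ne m : nat) (T : R).
Variables (Cva : R -> 'M[R]_(nv, n.+1)) (Dvw : R -> 'M[R]_(nv, nw))
  (Cea : R -> 'M[R]_(ne, n.+1)) (Dew : R -> 'M[R]_(ne, nw))
  (M : 'I_m -> 'M[R]_(nv + nw)).
Hypotheses (cCva : mxcont T Cva) (cDvw : mxcont T Dvw)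
  (cCea : mxcont T Cea) (cDew : mxcont T Dew)
  (symM : forall i, (M i)^T = M i).

Lemma Nmat_i_mxcont i : mxcont T (Nmat_i Cva Dvw M i).
Proof.
have cb : mxcont T (fun t => block_mx (Cva t) (Dvw t) 0 (1%:M : 'M[R]_nw)).
  by apply: (@mxcontinuous_block R (subspace `[0, T])); [| |exact: mxcont_cst..].
apply: mxcontM => //; apply: mxcontM; first exact: mxcont_tr.
exact: mxcont_cst.
Qed.

Lemma Nmat_mxcont lam : mxcont T (Nmat Cva Dvw Cea Dew M lam).
Proof.
have cr := @mxcontinuous_row R (subspace `[0, T]) _ _ _ _ _ cCea cDew.
apply: mxcontD; first by apply: mxcontM => //; exact: mxcont_tr.
move=> k l.
apply: (@within_ext R T (fun t => \sum_i lam i * Nmat_i Cva Dvw M i t k l)).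
  by move=> t _; rewrite summxE; apply: eq_bigr => i _; rewrite [RHS]mxE.
apply: (@continuous_sumr R (subspace `[0, T])) => i.
apply: (@continuous_mulr R (subspace `[0, T])); first exact: continuous_cstr.
exact: Nmat_i_mxcont.
Qed.

Lemma Nmat_i_sym i t : (Nmat_i Cva Dvw M i t)^T = Nmat_i Cva Dvw M i t.
Proof. by rewrite /Nmat_i !trmx_mul trmxK symM mulmxA. Qed.

Lemma Nmat_sym lam t : (Nmat Cva Dvw Cea Dew M lam t)^T = Nmat Cva Dvw Cea Dew M lam t.
Proof.
rewrite /Nmat trmx_add trmx_mul trmxK; congr (_ + _).
rewrite (big_morph _ (@trmx_add _ _ _) (@trmx0 _ _ _)).
by apply: eq_bigr => i _; rewrite trmx_scale Nmat_i_sym.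
Qed.

Lemma qf_Nmat lam alpha t v : qf (Nmat Cva Dvw Cea Dew M alpha t) v =
  qf (Nmat Cva Dvw Cea Dew M lam t) v
  + \sum_i (alpha i - lam i) * qf (Nmat_i Cva Dvw M i t) v.
Proof.
rewrite /Nmat !qfE !bfDm -addrA; congr (_ + _).
have bf_big (c : 'I_m -> R) : bf v (\sum_i c i *: Nmat_i Cva Dvw M i t) v =
    \sum_i c i * qf (Nmat_i Cva Dvw M i t) v.
  rewrite (big_morph (fun X => bf v X v) (fun X Y => bfDm v X Y v) (bf0m v v)).
  by apply: eq_bigr => i _; rewrite bfZm.
rewrite !bf_big -big_split/=; apply: eq_bigr => i _; ring.
Qed.

End IQC.

(** * Passage from the stated notions to the abstract LQ problem *)

Section Bridge.
Context {R : realType}.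
Variables (n nw nv ne m : nat) (T : R).
Variables (Aa : R -> 'M[R]_n.+1) (Ba : R -> 'M[R]_(n.+1, nw))
  (Cva : R -> 'M[R]_(nv, n.+1)) (Dvw : R -> 'M[R]_(nv, nw))
  (Cea : R -> 'M[R]_(ne, n.+1)) (Dew : R -> 'M[R]_(ne, nw))
  (M : 'I_m -> 'M[R]_(nv + nw)).

Lemma feasiblePE lam P : feasibleP T Aa Ba Cva Dvw Cea Dew M lam P <->
  feasible T Aa Ba (Nmat Cva Dvw Cea Dew M lam) P.
Proof.
by split=> -[h1 h2 h3 h4]; split => // t tT; [apply: h1|apply: h2|apply: h4|
  apply: h1|apply: h2|apply: h4]; rewrite ?mem_segment// -mem_segment.
Qed.

Lemma riccati_solE lam Y : riccati_sol T Aa Ba Cva Dvw Cea Dew M lam Y ->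
  Y T = 0 /\ riccati T Aa Ba (Nmat Cva Dvw Cea Dew M lam) Y (mxderive Y).
Proof.
move=> [YT ricY]; split => // t tT.
have {}tT : t \in `[0, T] by rewrite mem_segment.
have [dY E] := ricY t tT.
by split; [exact/is_mxderiveP|rewrite /riccati_res /gain mulmxA; exact: E].
Qed.

End Bridge.

Unset Implicit Arguments.

Theorem theorem3 (R : realType) (n nw nv ne m : nat) (T : R)
  (Aa : R -> 'M[R]_n.+1) (Ba : R -> 'M[R]_(n.+1, nw))
  (Cva : R -> 'M[R]_(nv, n.+1)) (Dvw : R -> 'M[R]_(nv, nw))
  (Cea : R -> 'M[R]_(ne, n.+1)) (Dew : R -> 'M[R]_(ne, nw))
  (M : 'I_m -> 'M[R]_(nv + nw)) (lam : 'I_m -> R) :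
  0 < T ->
  mxcont T Aa -> mxcont T Ba -> mxcont T Cva -> mxcont T Dvw ->
  mxcont T Cea -> mxcont T Dew ->
  (forall i, (M i)^T = M i) ->
  (forall t, t \in `[0, T] -> negdef (Rm Cva Dvw Cea Dew M lam t)) ->
  (Jcost T Aa Ba Cva Dvw Cea Dew M lam < +oo)%E ->
  (* (1) *)
  LQvalue T Aa Ba Cva Dvw Cea Dew M lam = Jcost T Aa Ba Cva Dvw Cea Dew M lam
  /\
  (* (2) and (3) *)
  (forall (Y : R -> 'M[R]_n.+1) (xs : R -> 'cV[R]_n.+1),
    riccati_sol T Aa Ba Cva Dvw Cea Dew M lam Y ->
    xs 0 = e_last n ->
    (forall t, t \in `[0, T] -> mxderivable xs t /\
       mxderive xs t =
         (Aa t - Ba t *m invmx (Rm Cva Dvw Cea Dew M lam t)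
            *m (Y t *m Ba t + Sm Cva Dvw Cea Dew M lam t)^T) *m xs t) ->
    let ws := fun t => - (invmx (Rm Cva Dvw Cea Dew M lam t)
                *m (Y t *m Ba t + Sm Cva Dvw Cea Dew M lam t)^T *m xs t) in
    let g := fun i : 'I_m => traj_cost T (Nmat_i Cva Dvw M i) xs ws in
    [/\ admissible T Aa Ba xs ws,
        (traj_cost T (Nmat Cva Dvw Cea Dew M lam) xs ws)%:E
          = Jcost T Aa Ba Cva Dvw Cea Dew M lam &
        forall alpha : 'I_m -> R,
          (Jcost T Aa Ba Cva Dvw Cea Dew M lam
             + (\sum_(i < m) g i * (alpha i - lam i))%:E
           <= Jcost T Aa Ba Cva Dvw Cea Dew M alpha)%E]).
Proof.
move=> T0 cA cB cCva cDvw cCea cDew symM negR Jfin.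
set N := Nmat Cva Dvw Cea Dew M.
have cN l : mxcont T (N l) by exact: Nmat_mxcont.
have symN l t : 0 <= t <= T -> (N l t)^T = N l t by move=> _; exact: Nmat_sym.
have negN t : 0 <= t <= T -> negdef (drsubmx (N lam t)).
  by rewrite -mem_segment; exact: negR.
have TT : 0 <= T <= T by rewrite lexx ltW.
(* Stated for any Riccati solution with its closed loop, because in (1) they are constructed and in
   (2) they are given. *)
have Jval Y dY xs : riccati T Aa Ba (N lam) Y dY -> Y T = 0 -> xs 0 = e_last n ->
    (forall t, 0 <= t <= T ->
       is_mxderive xs t ((Aa t - Ba t *m gain Ba (N lam) Y t) *m xs t)) ->
    Jcost T Aa Ba Cva Dvw Cea Dew M lam = (qf (Y 0) (e_last n))%:E.
  move=> ricY YT xs0 dxs; apply/eqP; rewrite eq_le; apply/andP; split.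
    apply/lee_addgt0Pr => eps eps0.
    have [P fP Pe] := riccati_feasible T0 cA cB (cN lam) (@symN lam) negN
      (e_last n) ricY YT eps0.
    apply: ge_ereal_inf; exists (qf (P 0) (e_last n))%:E; last by rewrite -EFinD lee_fin.
    by exists P => //; exact/feasiblePE.
  apply/ereal_infP => _ [P /feasiblePE fP <-]; rewrite lee_fin.
  exact: (riccati_le_feasible T0 cA cB (cN lam) (@symN lam) negN ricY YT xs0 dxs fP).
have adm Y dY xs : riccati T Aa Ba (N lam) Y dY -> xs 0 = e_last n ->
    (forall t, 0 <= t <= T ->
       is_mxderive xs t ((Aa t - Ba t *m gain Ba (N lam) Y t) *m xs t)) ->
    admissible T Aa Ba xs (feedback Ba (N lam) Y xs).
  move=> ricY xs0 dxs; split.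
  - exact: (feedback_L2 cB (cN lam) negN ricY dxs).
  - exact: (closed_loop_mxcont dxs).
  move=> t; rewrite mem_segment.
  exact: (feedback_integral cA cB (cN lam) negN ricY xs0 dxs).
split.
  (* Finiteness of J is used here: it supplies a feasible P, from which the Riccati solution is
     built. *)
  have [_ [P /feasiblePE fP _] _] := ereal_inf_lt Jfin.
  have [Y [dY [xs [ricY YT sY xs0 dxs]]]] :=
    riccati_exists T0 cA cB (cN lam) (@symN lam) negN (e_last n) fP.
  rewrite (Jval Y dY xs)//.
  apply/eqP; rewrite eq_le; apply/andP; split.
    apply/ereal_supP => _ [[x w] /= [L2w cx hx] <-]; rewrite lee_fin.
    apply: (cost_le_riccati T0 cA cB (cN lam) (@symN lam) negN ricY YT L2w cx).
    by move=> t; rewrite -mem_segment; exact: hx.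
  apply: ereal_sup_ubound; exists (xs, feedback Ba (N lam) Y xs) => /=.
    exact: adm ricY xs0 dxs.
  congr EFin.
  exact: (feedback_cost T0 cA cB (cN lam) (@symN lam) negN ricY YT xs0 dxs).
move=> Y xs /riccati_solE[YT ricY] xs0 hxs ws g.
have dxs t : 0 <= t <= T ->
    is_mxderive xs t ((Aa t - Ba t *m gain Ba (N lam) Y t) *m xs t).
  by rewrite -mem_segment => /hxs; rewrite -mulmxA => /is_mxderiveP.
have wsE : ws = feedback Ba (N lam) Y xs by [].
have Jeq := Jval Y (mxderive Y) xs ricY YT xs0 dxs.
have cost : traj_cost T (N lam) xs ws = qf (Y 0) (e_last n).
  exact: (feedback_cost T0 cA cB (cN lam) (@symN lam) negN ricY YT xs0 dxs).
split; [exact: adm ricY xs0 dxs|by rewrite Jeq cost|].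
(* Bounding the value of every P feasible for [alpha] also covers the infeasible case, where J is
   +oo. *)
move=> alpha; apply/ereal_infP => _ [P /feasiblePE fP <-].
rewrite Jeq -cost -EFinD lee_fin.
have cx := closed_loop_mxcont dxs.
have cw := feedback_mxcont cB (cN lam) negN ricY dxs.
have Ni_L1 (F : R -> 'M[R]_(n.+1 + nw)) : mxcont T F ->
    L1 T (fun t => qf (F t) (col_mx (xs t) (ws t))).
  move=> cF; apply: L1_continuous.
  have cxw := @mxcontinuous_col R (subspace `[0, T]) _ _ _ xs ws cx cw.
  exact: (@continuous_bf R (subspace `[0, T]) _ _ _ _ _ cxw cF cxw).
(* The pair optimal for [lam] serves as a trial pair for the weight at [alpha]; its cost there is
   J(lam) plus the linear term with coefficients g. *)
have := smooth_cost_le T0 (cN alpha) (@symN alpha) fP cw (feedback_derive dxs).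
rewrite xs0; apply: le_trans; rewrite /traj_cost.
rewrite [leRHS](Rint_ext TT (g := fun t => qf (N lam t) (col_mx (xs t) (ws t)) +
  \sum_i (alpha i - lam i) * qf (Nmat_i Cva Dvw M i t) (col_mx (xs t) (ws t)))); last first.
  by move=> t _; exact: qf_Nmat.
have Li i : L1 T (fun t => (alpha i - lam i) *
    qf (Nmat_i Cva Dvw M i t) (col_mx (xs t) (ws t))).
  by apply: L1Z; apply: Ni_L1; exact: Nmat_i_mxcont.
rewrite (Rint_add TT); [|exact: Ni_L1|exact: L1_sum].
rewrite lerD2l (Rint_sum TT Li) le_eqVlt; apply/orP; left; apply/eqP.
apply: eq_bigr => i _; rewrite (Rint_scale _ TT); first by rewrite mulrC.
by apply: Ni_L1; exact: Nmat_i_mxcont.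
Qed.
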